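(* Let $(x_n)_{n\in\mathbb{Z}}$ be the sequence of rational functions in two indeterminates $x_1,x_2$ determined by $x_nx_{n-2}=x_{n-1}+1$ for all odd $n\in\mathbb{Z}$ and $x_nx_{n-2}=x_{n-1}^4+1$ for all even $n\in\mathbb{Z}$ (the case $(b,c)=(1,4)$). Then for every integer $n\ne 1,2$, $$x_n(x_1,x_2)=\frac{p_n(x_1,x_2)}{m_n(x_1,x_2)},\qquad m_n(x_1,x_2)=x_1^{sq(n)}x_2^{oct(n)},$$ where $p_n(x_1,x_2)$ is the sum of the weights of all perfect matchings of the weighted graph $G_n$ defined in the context, and $$sq(n)=\begin{cases}|n-1|-1 & n\text{ odd}\\ |2n-2|-2 & n\text{ even}\end{cases}\qquad oct(n)=\begin{cases}\left|\tfrac n2-1\right|-\tfrac12 & n\text{ odd}\\ |n-2|-1 & n\text{ even.}\end{cases}$$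
   Context: A perfect matching of a graph is a set $S$ of edges such that each vertex belongs to exactly one edge of $S$; its weight is the product of the weights of its edges. Building blocks. An octagon is an 8-cycle with vertices, in clockwise order, $nl,nr,et,eb,sr,sl,wb,wt$. Its north edge $nl\,nr$, east edge $et\,eb$, south edge $sr\,sl$ and west edge $wb\,wt$ have weight $1$; the four remaining edges (diagonals) $nr\,et$, $eb\,sr$, $sl\,wb$, $wt\,nl$ have weight $x_1$. Attaching a north square to an octagon means adding two new vertices $u,v$ and the edges $nl\,u$, $u\,v$, $v\,nr$; attaching a south square means adding new vertices $u,v$ and the edges $sl\,u$, $u\,v$, $v\,sr$. The two edges joining new to old vertices are the vertical edges of the square; exactly one of them has weight $x_2$ (chosen to be one not incident with any of the arcs below; either one if neither is incident with an arc), and the other added edges have weight $1$. Attaching an end square on the east (resp. west) means adding new vertices $u,v$ and the edges $et\,u$, $u\,v$, $v\,eb$ (resp. $wt\,u$, $u\,v$, $v\,wb$); one (either one) of the two edges joining new to old vertices has weight $x_2$ and the other two added edges have weight $1$. Connecting an octagon $O$ (left) to an octagon $O'$ (right) by a connecting square means adding the top edge $et(O)\,wt(O')$ and the bottom edge $eb(O)\,wb(O')$; one of these has weight $x_2$, as specified below, and the other has weight $1$. An arc is an additional edge of weight $1$. The graphs $G_n$. (a) $G_3$ is a single square (4-cycle) with one edge of weight $x_2$ and three edges of weight $1$. For $k\ge1$, $G_{2k+3}$ has octagons $O_1,\dots,O_k$ arranged from right to left; $O_i$ has a south square if $i$ is odd and a north square if $i$ is even; $O_1$ has an east end square and $O_k$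 a west end square; for $1\le i<k$, $O_i$ and $O_{i+1}$ are connected by a connecting square whose $x_2$-edge is the top edge if $i$ is odd and the bottom edge if $i$ is even; and for $1\le i<k$ there is an arc joining $v_i$ and $v_{i+1}$, where $v_i=sr(O_i)$ for $i$ odd and $v_i=nr(O_i)$ for $i$ even. (d) For $k\ge1$, $G_{-2k+1}$ has octagons $O_1,\dots,O_k$ arranged from right to left; $O_i$ has a north square if $i$ is odd and a south square if $i$ is even; there are no end squares; for $1\le i<k$, $O_i$ and $O_{i+1}$ are connected by a connecting square whose $x_2$-edge is the top edge if $i$ is odd and the bottom edge if $i$ is even; and for $1\le i<k$ there is an arc joining $v_i$ and $v_{i+1}$, where $v_i=nl(O_i)$ for $i$ odd and $v_i=sl(O_i)$ for $i$ even. (b) For $k\ge1$, $G_{2k+2}$ has octagons $O_{-(k-1)},\dots,O_{k-1}$ arranged from left to right, consecutive ones connected by connecting squares. $O_0$ has both a north and a south square; for $1\le i\le k-1$, $O_i$ has a north square if $i$ is odd and a south square if $i$ is even, and $O_{-i}$ has a south square if $i$ is odd and a north square if $i$ is even; $O_{k-1}$ has an east end square and $O_{-(k-1)}$ a west end square. For $1\le i\le k-1$: the connecting square between $O_{i-1}$ and $O_i$ has its top edge of weight $x_2$ if $i$ is odd and its bottom edge if $i$ is even; the connecting square between $O_{-i}$ and $O_{-i+1}$ has its bottom edge of weight $x_2$ if $i$ is odd and its top edge if $i$ is even; there is an arc $v_{i-1}v_i$ and an arc $u_{i-1}u_i$, where $v_0=sl(O_0)$, $u_0=nr(O_0)$,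 and for $j\ge1$: $v_j=nl(O_j)$, $u_j=sr(O_{-j})$ if $j$ is odd, and $v_j=sl(O_j)$, $u_j=nr(O_{-j})$ if $j$ is even. (c) For $k\ge1$, $G_{-2k+2}$ has octagons $O_{-(k-1)},\dots,O_{k-1}$ arranged from left to right, consecutive ones connected by connecting squares. $O_0$ has no north or south square; for $1\le i\le k-1$, $O_i$ has a north square if $i$ is odd and a south square if $i$ is even, and $O_{-i}$ has a south square if $i$ is odd and a north square if $i$ is even; there are no end squares. For $1\le i\le k-1$: the connecting square between $O_{i-1}$ and $O_i$ has its bottom edge of weight $x_2$ if $i$ is odd and its top edge if $i$ is even; the connecting square between $O_{-i}$ and $O_{-i+1}$ has its top edge of weight $x_2$ if $i$ is odd and its bottom edge if $i$ is even; there is an arc $v_{i-1}v_i$ and an arc $u_{i-1}u_i$, where $v_0=sr(O_0)$, $u_0=nl(O_0)$, and for $j\ge1$: $v_j=nr(O_j)$, $u_j=sl(O_{-j})$ if $j$ is odd, and $v_j=sr(O_j)$, $u_j=nl(O_{-j})$ if $j$ is even. *)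

(* Defs.v *)
From HB Require Import structures.
From mathcomp Require Import all_boot all_order all_algebra.
From mathcomp Require Import fraction mpoly.

Set Implicit Arguments.
Unset Strict Implicit.
Unset Printing Implicit Defensive.

Import GRing.Theory.
Local Open Scope ring_scope.

(* The corners of an octagon, in clockwise order. *)
Variant corner := NL | NR | ET | EB | SR | SL | WB | WT.

Definition nat_of_corner (c : corner) : nat :=
  match c with
  | NL => 0 | NR => 1 | ET => 2 | EB => 3 | SR => 4 | SL => 5 | WB => 6 | WT => 7
  end%N.

Definition corner_of_nat (m : nat) : option corner :=
  nth None [:: Some NL; Some NR; Some ET; Some EB;
               Some SR; Some SL; Some WB; Some WT] m.

Lemma nat_of_cornerK : pcancel nat_of_corner corner_of_nat.
Proof. by case. Qed.

HB.instance Definition _ := Countable.copy corner (pcan_type nat_of_cornerK).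

Variant side := North | East | South | West.

Definition ends (s : side) : corner * corner :=
  match s with
  | North => (NL, NR) | East => (ET, EB) | South => (SL, SR) | West => (WT, WB)
  end.

(* (i, c, false) is the corner c of the octagon O_i.  Every corner lies on
   exactly one side, so at most one square attached to O_i adds a new vertex
   adjacent to c; that vertex is (i, c, true). *)
Definition vertex : Type := (int * corner * bool)%type.

Definition old (i : int) (c : corner) : vertex := (i, c, false).
Definition new (i : int) (c : corner) : vertex := (i, c, true).

Section WeightedGraphs.
Variable R : comNzRingType.

Definition wedge : Type := (vertex * vertex * R)%type.
Definition weight (e : wedge) : R := e.2.
Definition incident (v : vertex) (e : wedge) : bool :=
  (v == e.1.1) || (v == e.1.2).

(* The graphs considered have no isolated vertices and no repeated edges, so a
   graph is given by the list of its edges, and a set of edges is a set of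
   positions in that list. *)
Definition wgraph : Type := seq wedge.

Definition vertices (G : wgraph) : seq vertex :=
  undup (flatten [seq [:: e.1.1; e.1.2] | e <- G]).

Definition edge (G : wgraph) (j : 'I_(size G)) : wedge := tnth (in_tuple G) j.

Definition perfect_matching (G : wgraph) (S : {set 'I_(size G)}) : bool :=
  all (fun v => #|[set j in S | incident v (edge j)]| == 1%N) (vertices G).

Definition matching_poly (G : wgraph) : R :=
  \sum_(S : {set 'I_(size G)} | perfect_matching S)
     \prod_(j in S) weight (edge j).

Variables x1 x2 : R.

Definition octagon (i : int) : wgraph :=
  [:: (old i NL, old i NR, 1); (old i NR, old i ET, x1);
      (old i ET, old i EB, 1); (old i EB, old i SR, x1);
      (old i SR, old i SL, 1); (old i SL, old i WB, x1);
      (old i WB, old i WT, 1); (old i WT, old i NL, x1)].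

Definition connect (l r : int) (x2_on_top : bool) : wgraph :=
  [:: (old l ET, old r WT, if x2_on_top then x2 else 1);
      (old l EB, old r WB, if x2_on_top then 1 else x2)].

Definition arc (v w : vertex) : wedge := (v, w, 1).

(* The square attached to the side s of O_i, in presence of the arcs A.  The
   weight x2 goes to the edge at p or to the edge at q; it avoids the arcs, and
   where they leave the choice free it is made by the arbitrary function f.  The
   arcs considered never meet an east or west side, so f alone decides there. *)
Definition attach (A : wgraph) (f : int -> side -> bool) (i : int) (s : side) :
    wgraph :=
  let: (p, q) := ends s in
  let x2_at_p := if has (incident (old i p)) A then false
                 else if has (incident (old i q)) A then true
                 else f i s in
  [:: (old i p, new i p, if x2_at_p then x2 else 1);
      (new i p, new i q, 1);
      (new i q, old i q, if x2_at_p then 1 else x2)].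

Definition big_union (s : seq nat) (F : nat -> wgraph) : wgraph :=
  flatten [seq F i | i <- s].

Section Families.
Variable f : int -> side -> bool.

(* By rotational symmetry the choice of the edge of weight x2 is immaterial. *)
Definition G_3 : wgraph :=
  [:: (old 0 NL, old 0 NR, x2); (old 0 NR, old 0 SR, 1);
      (old 0 SR, old 0 SL, 1); (old 0 SL, old 0 NL, 1)].

(* G_(2k+3), k >= 1 *)
Definition G_odd_pos (k : nat) : wgraph :=
  let v (i : nat) := old i (if odd i then SR else NR) in
  let A := [seq arc (v i) (v i.+1) | i <- iota 1 k.-1] in
  big_union (iota 1 k) (fun i =>
    octagon i ++ attach A f i (if odd i then South else North))
  ++ attach A f 1 East ++ attach A f k West
  ++ big_union (iota 1 k.-1) (fun i => connect i.+1 i (odd i))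
  ++ A.

(* G_(-2k+1), k >= 1 *)
Definition G_odd_neg (k : nat) : wgraph :=
  let v (i : nat) := old i (if odd i then NL else SL) in
  let A := [seq arc (v i) (v i.+1) | i <- iota 1 k.-1] in
  big_union (iota 1 k) (fun i =>
    octagon i ++ attach A f i (if odd i then North else South))
  ++ big_union (iota 1 k.-1) (fun i => connect i.+1 i (odd i))
  ++ A.

(* G_(2k+2), k >= 1 *)
Definition G_even_pos (k : nat) : wgraph :=
  let v (j : nat) := old j (if odd j then NL else SL) in
  let u (j : nat) := old (- j%:Z) (if odd j then SR else NR) in
  let A := [seq arc (v i.-1) (v i) | i <- iota 1 k.-1]
           ++ [seq arc (u i.-1) (u i) | i <- iota 1 k.-1] in
  octagon 0 ++ attach A f 0 North ++ attach A f 0 South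
  ++ big_union (iota 1 k.-1) (fun i =>
       octagon i ++ attach A f i (if odd i then North else South)
       ++ octagon (- i%:Z)
       ++ attach A f (- i%:Z) (if odd i then South else North)
       ++ connect (i%:Z - 1) i (odd i)
       ++ connect (- i%:Z) (- i%:Z + 1) (~~ odd i))
  ++ attach A f (k%:Z - 1) East ++ attach A f (- (k%:Z - 1)) West
  ++ A.

(* G_(-2k+2), k >= 1 *)
Definition G_even_neg (k : nat) : wgraph :=
  let v (j : nat) := old j (if odd j then NR else SR) in
  let u (j : nat) := old (- j%:Z) (if odd j then SL else NL) in
  let A := [seq arc (v i.-1) (v i) | i <- iota 1 k.-1]
           ++ [seq arc (u i.-1) (u i) | i <- iota 1 k.-1] in
  octagon 0
  ++ big_union (iota 1 k.-1) (fun i =>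
       octagon i ++ attach A f i (if odd i then North else South)
       ++ octagon (- i%:Z)
       ++ attach A f (- i%:Z) (if odd i then South else North)
       ++ connect (i%:Z - 1) i (~~ odd i)
       ++ connect (- i%:Z) (- i%:Z + 1) (odd i))
  ++ A.

(* The values at n = 1 and n = 2 are junk. *)
Definition G_ (n : int) : wgraph :=
  if odd (absz n) then
    if n == 3 then G_3
    else if 3 < n then G_odd_pos (absz (n - 3))./2
    else G_odd_neg (absz (1 - n))./2
  else
    if 2 < n then G_even_pos (absz (n - 2))./2
    else G_even_neg (absz (2 - n))./2.

End Families.
End WeightedGraphs.

(* For n <> 1, 2 none of the subtractions of naturals below is truncated. *)
Definition sq (n : int) : nat :=
  if odd (absz n) then (absz (n - 1)%R - 1)%N
  else (absz (2 * n - 2)%R - 2)%N.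

(* For n odd, |n/2 - 1| - 1/2 = (|n - 2| - 1)/2, and the halving is exact. *)
Definition oct (n : int) : nat :=
  if odd (absz n) then (absz (n - 2)%R - 1)./2
  else (absz (n - 2)%R - 1)%N.

Definition X1 : {mpoly rat[2]} := 'X_(ord0 : 'I_2).
Definition X2 : {mpoly rat[2]} := 'X_(ord_max : 'I_2).

Definition p_ (f : int -> side -> bool) (n : int) : {mpoly rat[2]} :=
  matching_poly (G_ X1 X2 f n).

Definition m_ (n : int) : {mpoly rat[2]} := X1 ^+ sq n * X2 ^+ oct n.

(* Main.v *)
Require Import Defs.
From HB Require Import structures.
From mathcomp Require Import all_boot all_order all_algebra.
From mathcomp Require Import fraction mpoly.
From mathcomp Require Import ring zify.

(* Every G_n is a chain of octagons in which consecutive octagons are joined by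
   only three edges, so p_n is computed by a transfer matrix, one octagon at a
   time.  An arm (the part of the chain beyond some octagon) is described by the
   eight sums of weights of its matchings that leave unmatched a given subset of
   the three vertices where it is attached; five of them vanish, and the others
   are linear in two consecutive terms of
     e_(k+2) = (x_1^4 + (1 + x_2)^2) e_(k+1) - x_1^4 x_2^2 e_k.
   G_n is essentially one arm for n odd, hence p_n is linear in these terms; it
   consists of two arms for n even, hence p_n is quadratic.  On the other side, the
   terms y_k of odd index of the sequence have the conserved quantity
     K = (y_(k+1)^2 + y_k^2) / (y_k y_(k+1) - 1) = (x_1^4 + (1 + x_2)^2) / (x_1^2 x_2),
   which gives y_(k+1) + y_(k-1) = K y_k, the recurrence above up to monomial
   factors, and the terms of even index are the y_k y_(k+1) - 1. *)

Set Implicit Arguments.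
Unset Strict Implicit.
Unset Printing Implicit Defensive.

Import Order.TTheory GRing.Theory Num.Theory.
Local Open Scope ring_scope.

(** * Matchings as exact covers *)

Section ExactCovers.
Variables (V : eqType) (R : comNzRingType).
Implicit Types (G : seq (V * V * R)) (U S : seq V).

Definition rm U S := [seq v <- U | v \notin S].

Lemma mem_rm U S v : (v \in rm U S) = (v \notin S) && (v \in U).
Proof. by rewrite mem_filter. Qed.

Lemma rm_nil U : rm U [::] = U.
Proof. exact/all_filterP/allP. Qed.

Definition endpoints G := flatten [seq [:: e.1.1; e.1.2] | e <- G].

Lemma endpoints_cons e G :
  endpoints (e :: G) = [:: e.1.1, e.1.2 & endpoints G].
Proof. by []. Qed.

(* Sum of the weights of the matchings of [G] with set of matched vertices [U]. *)
Fixpoint covers G U : R :=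
  if G is e :: G' then
    covers G' U
    + (if (e.1.1 \in U) && (e.1.2 \in U)
       then e.2 * covers G' (rm U [:: e.1.1; e.1.2]) else 0)
  else (nilp U)%:R.

(** [covers] only tests membership in [U] and its emptiness, so [U] stands for a set, and
    [endpoints G], which repeats vertices, can serve as the set of all vertices. *)
Lemma covers_eqi G U U' : U =i U' -> covers G U = covers G U'.
Proof.
elim: G U U' => [|e G IH] U U' eqU /=.
  case: U U' eqU => [|x U] [|x' U'] //= eqU.
    by have := eqU x'; rewrite !inE eqxx.
  by have := eqU x; rewrite !inE eqxx.
rewrite !eqU (IH _ _ eqU); congr (_ + _); case: ifP => // _.
by congr (_ * _); apply: IH => v; rewrite !mem_rm eqU.
Qed.

(** A matching uses both edges only when they share no end, and then the order of the removals is
    irrelevant. *)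
Lemma covers_swap e e' G U : covers (e :: e' :: G) U = covers (e' :: e :: G) U.
Proof.
rewrite /= !mem_rm !inE.
case: e e' => [[a b] w] [[c d] w'] /=.
have -> : covers G (rm (rm U [:: a; b]) [:: c; d])
        = covers G (rm (rm U [:: c; d]) [:: a; b]).
  by apply: covers_eqi => v; rewrite !mem_rm !andbA [X in X && _]andbC.
rewrite [c == a]eq_sym [c == b]eq_sym [d == a]eq_sym [d == b]eq_sym.
by case: (a \in U); case: (b \in U); case: (c \in U); case: (d \in U);
  case: (a == c); case: (b == c); case: (a == d); case: (b == d) => /=; ring.
Qed.

Lemma covers_rev_edge a b w G U : covers ((a, b, w) :: G) U = covers ((b, a, w) :: G) U.
Proof.
rewrite /= andbC; congr (_ + _); case: ifP => // _; congr (_ * _).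
by apply: covers_eqi => v; rewrite !mem_rm !inE orbC.
Qed.

Lemma covers_cons_eq e G G' : covers G =1 covers G' -> covers (e :: G) =1 covers (e :: G').
Proof. by move=> eqG U /=; rewrite !eqG. Qed.

Lemma covers_cat2l G0 G G' :
  covers G =1 covers G' -> covers (G0 ++ G) =1 covers (G0 ++ G').
Proof. by move=> eqG; elim: G0 => //= e G0 IH U; rewrite !IH. Qed.

Lemma covers_perm G G' : perm_eq G G' -> covers G =1 covers G'.
Proof.
elim: G G' => [|e G IH] G'; first by rewrite perm_sym => /perm_nilP ->.
move=> eqG; have: e \in G' by rewrite -(perm_mem eqG) mem_head.
move=> eG'; case/splitPr: eG' eqG => G1 G2 eqG.
have {}eqG : perm_eq G (G1 ++ G2).
  by rewrite -(perm_cons e) (permPl eqG) (perm_catCA G1 [:: e] G2).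
move=> U; rewrite (covers_cons_eq e (IH _ eqG)) {eqG IH G}.
elim: G1 U => //= e' G1 IH U.
by rewrite -![in RHS]IH -/(covers (e' :: e :: _) U) covers_swap.
Qed.

Lemma covers_uncovered G U v : v \in U -> v \notin endpoints G -> covers G U = 0.
Proof.
elim: G U => [|e G IH] U vU; first by case: U vU.
rewrite endpoints_cons !inE !negb_or => /and3P[ne1 ne2 nG] /=.
rewrite !IH ?mem_rm ?inE ?negb_or ?ne1 ?ne2 // add0r.
by case: ifP; rewrite ?mulr0.
Qed.

(** No edge of one graph meets the vertices to be matched in the other, so a matching of the union
    splits into two independent ones. *)
Lemma covers_cat G1 G2 U1 U2 :
    {in U2, forall v, v \notin endpoints G1} ->
    {in U1, forall v, v \notin endpoints G2} ->
  covers (G1 ++ G2) (U1 ++ U2) = covers G1 U1 * covers G2 U2.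
Proof.
elim: G1 U1 => [|e G1 IH] U1 dis2 dis1 /=.
  case: U1 dis1 => [|v U1] dis1; first by rewrite mul1r.
  rewrite mul0r (@covers_uncovered _ _ v) ?mem_head //.
  by apply: dis1; rewrite mem_head.
have d2 : {in U2, forall v, v \notin endpoints G1}.
  by move=> v /dis2; rewrite endpoints_cons !inE !negb_or => /and3P[].
rewrite IH // mulrDl; congr (_ + _); rewrite !mem_cat.
have nU2 v : v \in [:: e.1.1; e.1.2] -> (v \in U2) = false.
  move=> ve; apply/negP => /dis2; move: ve; rewrite endpoints_cons !inE.
  by rewrite !negb_or; case: eqP; case: eqP.
rewrite !nU2 ?inE ?eqxx ?orbT // !orbF; case: ifP => _; last by rewrite mul0r.
rewrite -mulrA -IH //; last by move=> v; rewrite mem_rm => /andP[_ /dis1].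
congr (_ * _); apply: covers_eqi => v; rewrite mem_rm !mem_cat mem_rm andb_orr.
congr (_ || _); case vU2: (v \in U2); rewrite ?andbF // andbT.
by apply/negP => /nU2; rewrite vU2.
Qed.

Fixpoint masks n : seq bitseq :=
  if n is n'.+1 then map (cons false) (masks n') ++ map (cons true) (masks n')
  else [:: [::]].

Definition wprod (m : bitseq) (ws : seq R) := \prod_(w <- mask m ws) w.

(* The graphs [G1] and [G2] are joined by the edges from [As] to [Bs]; the mask [m]
   tells which of these edges are used. *)
Lemma covers_bridge As Bs ws G1 G2 U1 U2 :
    size Bs = size As -> size ws = size As -> uniq As -> uniq Bs ->
    {subset Bs <= U2} -> {in As, forall v, v \notin U2} ->
    {in U2, forall v, v \notin U1} ->
    {in U2, forall v, v \notin endpoints G1} ->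
    {in U1, forall v, v \notin endpoints G2} ->
  covers (zip (zip As Bs) ws ++ G1 ++ G2) (U1 ++ U2) =
  \sum_(m <- masks (size As))
     if all (mem U1) (mask m As) then
       wprod m ws * covers G1 (rm U1 (mask m As)) * covers G2 (rm U2 (mask m Bs))
     else 0.
Proof.
elim: As Bs ws U1 U2 => [|a As IH] [|b Bs] [|w ws] //= U1 U2.
  by move=> _ _ _ _ _ _ _ d1 d2; rewrite big_seq1 /= /wprod big_nil mul1r !rm_nil covers_cat.
move=> [sB] [sw] /andP[aAs uA] /andP[bBs uB] sBU dA dU d1 d2.
have dA' : {in As, forall v, v \notin U2} by move=> v vA; apply: dA; rewrite inE vA orbT.
have sB' : {subset Bs <= U2} by move=> v vB; apply: sBU; rewrite inE vB orbT.
have bU2 : b \in U2 by apply: sBU; rewrite mem_head.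
have aU2 : a \notin U2 by apply: dA; rewrite mem_head.
rewrite IH // big_cat !big_map; congr (_ + _).
rewrite !mem_cat (negPf aU2) bU2 orbF orbT andbT /=.
case: ifP => aU1; last by rewrite big1 // => m _; rewrite aU1.
have bU1 : b \notin U1 by apply: dU.
have -> : covers (zip (zip As Bs) ws ++ G1 ++ G2) (rm (U1 ++ U2) [:: a; b])
        = covers (zip (zip As Bs) ws ++ G1 ++ G2) (rm U1 [:: a] ++ rm U2 [:: b]).
  apply: covers_eqi => v; rewrite mem_rm !mem_cat !mem_rm !inE negb_or.
  have [->|_] := eqVneq v a; first by rewrite (negPf aU2) andbF.
  by have [->|_] := eqVneq v b; rewrite // (negPf bU1).
rewrite IH //.
- rewrite big_distrr /=; apply: eq_bigr => m _.
  have aM : a \notin mask m As by apply: contra aAs; apply: mem_mask.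
  have bM : b \notin mask m Bs by apply: contra bBs; apply: mem_mask.
  have -> : all (mem (rm U1 [:: a])) (mask m As) = all (mem U1) (mask m As).
    apply: eq_in_all => v vM /=; rewrite mem_rm inE.
    by have [va|//] := eqVneq v a; rewrite -va vM in aM.
  case: ifP => _; last by rewrite mulr0.
  rewrite /wprod /= big_cons !mulrA; congr (_ * _ * _);
    apply: covers_eqi => v; rewrite !mem_rm !inE negb_or andbA;
    by rewrite [X in X && _ = _]andbC.
- move=> v vB; rewrite mem_rm inE sB' // andbT.
  by apply: contra bBs => /eqP <-.
- by move=> v vA; rewrite mem_rm (negPf (dA' v vA)) andbF.
- by move=> v; rewrite !mem_rm => /andP[_ /dU] /negPf ->; rewrite andbF.
- by move=> v; rewrite mem_rm => /andP[_ /d1].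
- by move=> v; rewrite mem_rm => /andP[_ /d2].
Qed.

End ExactCovers.

Section MonomialWeights.
Variables (L V : eqType) (R : comNzRingType) (x1 x2 : R).
Implicit Types (G : seq (L * L * (nat * nat))) (U S : seq L).

(* Covers of a graph whose weights are the monomials [x1 ^+ i * x2 ^+ j], as the
   list of their exponents; unlike [covers], it can be evaluated. *)
Fixpoint lcovers G U : seq (nat * nat) :=
  if G is e :: G' then
    lcovers G' U
    ++ (if (e.1.1 \in U) && (e.1.2 \in U) then
          [seq (e.2.1 + p.1, e.2.2 + p.2)%N | p <- lcovers G' (rm U [:: e.1.1; e.1.2])]
        else [::])
  else if nilp U then [:: (0, 0)%N] else [::].

Definition xmon (p : nat * nat) : R := x1 ^+ p.1 * x2 ^+ p.2.

Definition msum (s : seq (nat * nat)) : R := \sum_(p <- s) xmon p.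

Definition place (h : L -> V) G :=
  [seq (h e.1.1, h e.1.2, xmon e.2) | e <- G].

Lemma rm_map (h : L -> V) U S : injective h -> rm (map h U) (map h S) = map h (rm U S).
Proof.
by move=> injh; rewrite /rm filter_map; congr map; apply: eq_filter => v /=; rewrite mem_map.
Qed.

Lemma covers_place h G U : injective h -> covers (place h G) (map h U) = msum (lcovers G U).
Proof.
move=> injh; elim: G U => [|e G IH] U /=.
  by case: U => [|v U]; rewrite /msum ?big_nil // big_seq1 /xmon !expr0 mulr1.
rewrite !mem_map // [rm (map h U) _](rm_map U [:: e.1.1; e.1.2]) // !IH /msum big_cat.
congr (_ + _).
case: ifP => _; last by rewrite big_nil.
rewrite big_map big_distrr; apply: eq_bigr => p _.
by rewrite /xmon /= !exprD; ring.
Qed.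

End MonomialWeights.

(** * Perfect matchings as exact covers of all vertices *)

Section MatchingPoly.
Variable R : comNzRingType.
Implicit Types (G : wgraph R).

Lemma edge_ord0 (e : wedge R) G : edge (G := e :: G) ord0 = e.
Proof. by rewrite /edge (tnth_nth e). Qed.

Lemma edge_lift (e : wedge R) G (j : 'I_(size G)) :
  edge (G := e :: G) (lift ord0 j) = edge j.
Proof. by rewrite /edge !(tnth_nth e). Qed.

(** A set of positions in [e :: G] is encoded by whether it contains [e] and by its trace on [G];
    this turns a sum over sets of edges into the branching of [covers]. *)
Definition add_ord0 n (bS : bool * {set 'I_n}) : {set 'I_n.+1} :=
  [set j | if unlift ord0 j is Some j' then j' \in bS.2 else bS.1].

Lemma add_ord0_bij n : bijective (@add_ord0 n).
Proof.
exists (fun S : {set 'I_n.+1} => (ord0 \in S, [set j : 'I_n | lift ord0 j \in S])).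
  move=> [b S]; congr (_, _); first by rewrite inE unlift_none.
  by apply/setP => j; rewrite !inE liftK.
move=> S; apply/setP => j; rewrite inE.
by case: unliftP => [j' ->|->]; rewrite ?inE.
Qed.

Lemma big_add_ord0 (T : Type) (idx : T) (op : Monoid.com_law idx) n b (S : {set 'I_n}) P F :
  \big[op/idx]_(j in add_ord0 (b, S) | P j) F j =
  op (if b && P ord0 then F ord0 else idx)
     (\big[op/idx]_(j in S | P (lift ord0 j)) F (lift ord0 j)).
Proof.
rewrite big_mkcond big_ord_recl inE unlift_none; congr (op _ _).
rewrite [RHS]big_mkcond; apply: eq_bigr => j _.
by rewrite inE liftK.
Qed.

Definition degree G (S : {set 'I_(size G)}) v : nat :=
  (\sum_(j in S | incident v (edge j)) 1)%N.

Lemma degreeE G (S : {set 'I_(size G)}) v :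
  #|[set j in S | incident v (edge j)]| = degree S v.
Proof. by rewrite -sum1_card /degree; apply: eq_bigl => j; rewrite inE. Qed.

Lemma degree_add_ord0 (e : wedge R) G b (S : {set 'I_(size G)}) v :
  degree (G := e :: G) (add_ord0 (b, S)) v = (b && incident v e + degree S v)%N.
Proof.
rewrite /degree big_add_ord0 edge_ord0 /=; congr (_ + _)%N.
by apply: eq_bigl => j; rewrite edge_lift.
Qed.

(** Induction on the edges leaves perfect matchings, because choosing an edge removes its ends. The
    statement therefore prescribes the set [U] of matched vertices, and asks for degree 0 at the
    other vertices of [vs]. *)
Lemma covers_sum G U (vs : seq vertex) :
    {subset U <= vs} -> {subset endpoints G <= vs} ->
  \sum_(S : {set 'I_(size G)} | all (fun v => degree S v == (v \in U)) vs)
     \prod_(j in S) weight (edge j) = covers G U.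
Proof.
elim: G U => [|e G IH] U Uvs Gvs.
  rewrite big_mkcond (big_pred1 set0) => [|S] /=; last first.
    by apply/esym/eqP/setP => -[].
  rewrite big_set0; case: ifP => [/allP|] eqU.
    case: U => //= v U in Uvs eqU *.
    have := eqU v (Uvs v (mem_head _ _)).
    by rewrite mem_head /degree big1 // => -[].
  case: U {Uvs} eqU => //= /negP[]; apply/allP => v _.
  by rewrite /degree big1 // => -[].
have [e1 e2] : e.1.1 \in vs /\ e.1.2 \in vs.
  by split; apply: Gvs; rewrite endpoints_cons !inE eqxx ?orbT.
have Gvs' : {subset endpoints G <= vs}.
  by move=> v vG; apply: Gvs; rewrite endpoints_cons !inE vG !orbT.
rewrite (reindex _ (onW_bij _ (add_ord0_bij (size G)))) big_mkcond.
rewrite -(pair_bigA _ (fun b S =>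
  if all (fun v => degree (G := e :: G) (add_ord0 (b, S)) v == (v \in U)) vs
  then \prod_(j in add_ord0 (b, S)) weight (edge (G := e :: G) j) else 0)) /=.
rewrite big_bool /= addrC -!big_mkcond /=; congr (_ + _).
  rewrite -IH //; apply: eq_big => [S|S _].
    by apply: eq_all => v; rewrite degree_add_ord0.
  rewrite (eq_bigl (fun j => (j \in add_ord0 (false, S)) && true)) => [|j]; last by rewrite andbT.
  rewrite big_add_ord0 /= mul1r; apply: eq_big => j; first by rewrite andbT.
  by rewrite edge_lift.
(* An end of [e] outside [U] would need degree 0, but choosing [e] gives it positive degree. *)
case: ifP => eU; last first.
  rewrite big1 // => S /allP deg; move: (deg _ e1) (deg _ e2) eU.
  rewrite !degree_add_ord0 /incident !eqxx orbT /=.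
  by case: (e.1.1 \in U); case: (e.1.2 \in U).
case/andP: eU => eU1 eU2.
rewrite -IH //; last by move=> v; rewrite mem_rm => /andP[_ /Uvs].
rewrite big_distrr; apply: eq_big => [S|S _].
  apply: eq_all => v; rewrite degree_add_ord0 mem_rm !inE /incident.
  have [->|_] /= := eqVneq v e.1.1; first by rewrite eU1 eqSS.
  by have [->|_] /= := eqVneq v e.1.2; first by rewrite eU2 eqSS.
rewrite (eq_bigl (fun j => (j \in add_ord0 (true, S)) && true)) => [|j]; last by rewrite andbT.
rewrite big_add_ord0 edge_ord0 /=; congr (_ * _).
by apply: eq_big => j; rewrite ?andbT ?edge_lift.
Qed.

Lemma matching_polyE G : matching_poly G = covers G (endpoints G).
Proof.
rewrite -(@covers_sum _ _ (vertices G)) /matching_poly.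
- apply: eq_bigl => S; apply: eq_in_all => v.
  by rewrite mem_undup degreeE => ->.
- by move=> v; rewrite mem_undup.
- by move=> v; rewrite mem_undup.
Qed.

End MatchingPoly.

(** * Octagons with their squares *)

(* Graphs on the vertices of a single octagon, with edge weights given by their
   exponents; [place (at_ i)] realizes them on O_i. *)
Definition lvertex : Type := (corner * bool)%type.
Definition lgraph : Type := seq (lvertex * lvertex * (nat * nat)).

Definition at_ (i : int) (v : lvertex) : vertex := (i, v.1, v.2).

Lemma at_inj i : injective (at_ i).
Proof. by move=> [c b] [c' b'] []/= -> ->. Qed.

Definition octagonL : lgraph :=
  [seq (e.1.1, false, (e.1.2, false), e.2) | e <-
    [:: (NL, NR, (0, 0)); (NR, ET, (1, 0)); (ET, EB, (0, 0)); (EB, SR, (1, 0));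
        (SR, SL, (0, 0)); (SL, WB, (1, 0)); (WB, WT, (0, 0)); (WT, NL, (1, 0))]%N].

Definition squareL (s : side) (x2_at_p : bool) : lgraph :=
  let: (p, q) := ends s in
  [:: (p, false, (p, true), if x2_at_p then (0, 1) else (0, 0));
      (p, true, (q, true), (0, 0));
      (q, true, (q, false), if x2_at_p then (0, 0) else (0, 1))]%N.

Definition x2_first (R : comNzRingType) (A : wgraph R) (f : int -> side -> bool) i s :=
  let: (p, q) := ends s in
  if has (incident (old i p)) A then false
  else if has (incident (old i q)) A then true else f i s.

Definition lendpoints (G : lgraph) : seq lvertex :=
  flatten [seq [:: e.1.1; e.1.2] | e <- G].

(* The edges leaving [G] from [outs] have the weights [ws]; those of the mask [m]
   are used, and the vertices [S] are matched elsewhere. *)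
Definition bridge_covers (G : lgraph) S outs (ws : seq (nat * nat)) (m : bitseq) :=
  let U := rm (lendpoints G) S in
  if all (mem U) (mask m outs) then
    [seq (sumn (unzip1 (mask m ws)) + p.1, sumn (unzip2 (mask m ws)) + p.2)%N
       | p <- lcovers G (rm U (mask m outs))]
  else [::].

Section Cells.
Variables (R : comNzRingType) (x1 x2 : R).

Lemma octagonE i : octagon x1 i = place x1 x2 (at_ i) octagonL.
Proof. by rewrite /place /= /xmon /= !expr0 expr1 !mulr1. Qed.

Lemma attachE A f i s :
  attach x2 A f i s = place x1 x2 (at_ i) (squareL s (x2_first A f i s)).
Proof.
rewrite /attach /x2_first /squareL; case: (ends s) => p q.
case: (if has _ _ then false else _);
  by rewrite /place /= /xmon /= !expr0 expr1 !mulr1 ?mul1r.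
Qed.

Lemma endpoints_cat (V : eqType) (G1 G2 : seq (V * V * R)) :
  endpoints (G1 ++ G2) = endpoints G1 ++ endpoints G2.
Proof. by rewrite /endpoints map_cat flatten_cat. Qed.

Lemma endpoints_place i G : endpoints (place x1 x2 (at_ i) G) = map (at_ i) (lendpoints G).
Proof. by elim: G => //= e G IH; rewrite endpoints_cons IH. Qed.

Lemma endpoints_zip (V : eqType) (As Bs : seq V) (ws : seq R) :
  {subset endpoints (zip (zip As Bs) ws) <= As ++ Bs}.
Proof.
elim: As Bs ws => [|a As IH] [|b Bs] [|w ws] v //=.
rewrite endpoints_cons !inE mem_cat !inE.
by case/or3P => [->|->|/IH]; rewrite ?orbT // mem_cat => /orP[] ->; rewrite ?orbT.
Qed.

Lemma wprod_xmon m ws :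
  wprod m (map (xmon x1 x2) ws) =
  xmon x1 x2 (sumn (unzip1 (mask m ws)), sumn (unzip2 (mask m ws))).
Proof.
rewrite /wprod -map_mask big_map; elim: (mask m ws) => [|w s IH] /=.
  by rewrite big_nil /xmon !expr0 mulr1.
by rewrite big_cons IH /xmon /= !exprD; ring.
Qed.

(** One step of the transfer matrix: once the used bridge edges are fixed, their ends are removed on
    both sides, and the cell at [i] and the rest [G2] are covered independently. The factor of the
    cell is an explicit list of exponents. *)
Lemma covers_cell_bridge i G S outs ins ws (G2 : wgraph R) :
    size ins = size outs -> size ws = size outs -> uniq outs -> uniq ins ->
    {subset outs <= lendpoints G} -> {subset ins <= endpoints G2} ->
    {in endpoints G2, forall v, v.1.1 != i} ->
  let G' := zip (zip (map (at_ i) outs) ins) (map (xmon x1 x2) ws)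
            ++ place x1 x2 (at_ i) G ++ G2 in
  covers G' (rm (endpoints G') (map (at_ i) S)) =
  \sum_(m <- masks (size outs))
     msum x1 x2 (bridge_covers G S outs ws m) * covers G2 (rm (endpoints G2) (mask m ins)).
Proof.
move=> si sw uo ui so2 si2 dis G'.
have nat2 v : (at_ i v) \notin endpoints G2 by apply/negP => /dis; rewrite eqxx.
have nat2' v (U : seq lvertex) : v \in endpoints G2 -> v \notin map (at_ i) U.
  by move=> vG; apply/mapP => -[u _ vu]; rewrite vu (negPf (nat2 u)) in vG.
(* The ends of the bridge edges are already vertices of the cell or of [G2], so the bridge adds no
   vertex. *)
have -> : covers G' (rm (endpoints G') (map (at_ i) S)) =
          covers G' (map (at_ i) (rm (lendpoints G) S) ++ endpoints G2).
  apply: covers_eqi => v; rewrite mem_cat -(rm_map _ _ (@at_inj i)) !mem_rm.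
  rewrite !endpoints_cat !mem_cat endpoints_place.
  case vG2: (v \in endpoints G2); first by rewrite nat2' // !orbT.
  rewrite !orbF; case vG: (v \in map _ (lendpoints G)); first by rewrite orbT.
  rewrite orbF; congr (_ && _); apply/negP => /endpoints_zip.
  rewrite mem_cat => /orP[/mapP[u uo' vu]|/si2]; last by rewrite vG2.
  by rewrite vu map_f ?so2 in vG.
rewrite covers_bridge ?size_map ?map_inj_uniq //; try exact: at_inj.
- apply: eq_bigr => m _; rewrite /bridge_covers -map_mask all_map.
  have -> : all (preim (at_ i) (mem (map (at_ i) (rm (lendpoints G) S)))) (mask m outs)
          = all (mem (rm (lendpoints G) S)) (mask m outs).
    by apply: eq_all => v /=; rewrite mem_map //; apply: at_inj.
  case: ifP => _; last by rewrite /msum big_nil mul0r.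
  congr (_ * _); rewrite rm_map ?covers_place; try exact: at_inj.
  rewrite wprod_xmon /msum big_map big_distrr; apply: eq_bigr => p _.
  by rewrite /xmon /= !exprD; ring.
- by move=> v /mapP[u _ ->].
- by move=> v; apply: nat2'.
- by move=> v; rewrite endpoints_place; apply: nat2'.
- by move=> v /mapP[u _ ->].
Qed.

End Cells.

(** * Arms *)

(* Up to reflections there are two kinds of arms, one for the graphs G_n with n >= 3
   and one ([ng] = true) for those with n <= 0.  They are described below for an arm
   leaving to the right, attached to the rest of the graph by [ins] (the third of
   which carries an arc), and starting with an octagon whose square is on the north
   side; [d] tells that it leaves to the left instead, [o] that the first square is
   on the south side.  The squares of the next octagons alternate. *)
Definition mirror c :=
  match c with
  | NL => NR | NR => NL | ET => WT | WT => ET | EB => WB | WB => EB | SR => SL | SL => SR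
  end.

Definition flip c :=
  match c with
  | NL => SL | SL => NL | NR => SR | SR => NR | ET => EB | EB => ET | WT => WB | WB => WT
  end.

Definition turn (d o : bool) c : lvertex :=
  ((if d then mirror else id) ((if o then flip else id) c), false).

(** Each list of exponents under [msum] is computed, lists already in normal form being skipped; the
    sums then become polynomials for [ring]. *)
Ltac evaluate :=
  repeat match goal with |- context [@msum _ _ _ ?exps] =>
    lazymatch exps with
    | nil => fail
    | cons _ _ => fail
    | _ => let val := eval vm_compute in exps in
           replace exps with val by vm_cast_no_check (@erefl (seq (nat * nat)) val)
    end
  end;
  rewrite /msum ?(big_cons, big_nil) /xmon /= ?expr0 ?expr1.

Section Arms.
Variable ng : bool.

Definition arc_corner := if ng then NR else NL.
Definition ins d o := map (turn d o) [:: WT; WB; arc_corner].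
(** [EB] comes first because the next cell is flipped: there [WT] in [ins] becomes the corner [WB]
    facing [EB]. *)
Definition outs d o := map (turn d o) [:: EB; ET; arc_corner].
Definition bridge_exps : seq (nat * nat) :=
  (if ng then [:: (0, 0); (0, 1); (0, 0)] else [:: (0, 1); (0, 0); (0, 0)])%N.

(** The bit [ng (+) d] puts the weight x_2 of the square at the corner opposite to the one that
    carries the arcs. *)
Definition cell (d o : bool) : lgraph :=
  octagonL ++ squareL (if o then South else North) (ng (+) d).

Definition last_cell (d o b : bool) : lgraph :=
  cell d o ++ (if ng then [::] else squareL (if d then West else East) b).

Variables (R : comNzRingType) (x1 x2 : R).

(* The terms of odd index of the sequence satisfy the same recurrence once
   multiplied by monomials. *)
Fixpoint cheb (k : nat) : R :=
  if k is k'.+1 then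
    if k' is k''.+1 then
      (x1 ^+ 4 + (1 + x2) ^+ 2) * cheb k' - x1 ^+ 4 * x2 ^+ 2 * cheb k''
    else 1
  else 0.

Lemma chebSS k :
  cheb k.+2 = (x1 ^+ 4 + (1 + x2) ^+ 2) * cheb k.+1 - x1 ^+ 4 * x2 ^+ 2 * cheb k.
Proof. by []. Qed.

(* [u] and [v] are consecutive terms of [cheb]. *)
Definition amp (u v : R) (m : bitseq) : R :=
  match m with
  | [:: false; false; false] => if ng then u - x2 * (1 + x2) * v else u
  | [:: true; true; false] => if ng then (1 + x2) * v else u - x1 ^+ 4 * v
  | [:: true; false; true] => if ng then 0 else x1 ^+ 3 * v
  | [:: false; true; true] => if ng then x1 * v else 0
  | _ => 0
  end.

(** Since [amp] vanishes on five masks, only three values of [F] have to be computed. *)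
Lemma sum_amp F u v :
  \sum_(m <- masks 3) F m * amp u v m =
  if ng then
    F [:: false; false; false] * (u - x2 * (1 + x2) * v)
    + F [:: true; true; false] * ((1 + x2) * v) + F [:: false; true; true] * (x1 * v)
  else
    F [:: false; false; false] * u
    + F [:: true; true; false] * (u - x1 ^+ 4 * v) + F [:: true; false; true] * (x1 ^+ 3 * v).
Proof. by rewrite /= !(big_cons, big_nil) /amp; case: ng => /=; ring. Qed.

(** The vectors [amp u v] form a family stable under the transfer matrix of a cell, which acts on it
    as one step of the recurrence of [cheb]. The mask [M] tells which of the three attaching
    vertices are matched outside. *)
Lemma cell_transfer d o u v M : size M = 3 ->
  \sum_(m <- masks 3)
     msum x1 x2 (bridge_covers (cell d o) (mask M (ins d o)) (outs d o) bridge_exps m)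
       * amp u v m
  = amp ((x1 ^+ 4 + (1 + x2) ^+ 2) * u - x1 ^+ 4 * x2 ^+ 2 * v) u M.
Proof.
rewrite sum_amp /cell /ins /outs /bridge_exps /amp /arc_corner.
(* Finite check: eight masks [M] for each of the eight choices of [ng], [d], [o]. *)
by case: M => [|[] [|[] [|[] [|]]]] // _; case: ng; case: d; case: o; evaluate; ring.
Qed.

(** Initial vector of the transfer: an arm with a single octagon, for either choice [b] of the edge
    of weight x_2 in the end square. *)
Lemma last_cell_covers d o b M : size M = 3 ->
  msum x1 x2 (lcovers (last_cell d o b) (rm (lendpoints (last_cell d o b)) (mask M (ins d o))))
  = amp (cheb 2) (cheb 1) M.
Proof.
rewrite chebSS mulr0 subr0 /last_cell /cell /ins /amp /arc_corner.
case: M => [|[] [|[] [|[] [|]]]] // _; case: ng; case: d; case: o; case: b;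
  by evaluate => //; ring.
Qed.

End Arms.

Arguments place : simpl never.
Arguments cell : simpl never.
Arguments last_cell : simpl never.

Section ArmCovers.
Variables (R : comNzRingType) (x1 x2 : R) (ng : bool).

Definition bridge d o i j : wgraph R :=
  zip (zip (map (at_ i) (outs ng d o)) (map (at_ j) (ins ng d (~~ o))))
      (map (xmon x1 x2) (bridge_exps ng)).

Variables (d b : bool) (pos : nat -> int).

(** The arm has m + 1 octagons, at [pos j], ..., [pos (j + m)], the last of which is a
    [last_cell]. *)
Fixpoint arm (o : bool) (j m : nat) : wgraph R :=
  if m is m'.+1 then
    bridge d o (pos j) (pos j.+1) ++ place x1 x2 (at_ (pos j)) (cell ng d o)
    ++ arm (~~ o) j.+1 m'
  else place x1 x2 (at_ (pos j)) (last_cell ng d o b).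

Lemma arm0 o j : arm o j 0 = place x1 x2 (at_ (pos j)) (last_cell ng d o b).
Proof. by []. Qed.

Lemma armS o j m :
  arm o j m.+1 = bridge d o (pos j) (pos j.+1)
                 ++ place x1 x2 (at_ (pos j)) (cell ng d o) ++ arm (~~ o) j.+1 m.
Proof. by []. Qed.

Lemma mem_endpoints_arm o j m v :
  v \in endpoints (arm o j m) -> exists2 k, (j <= k)%N & v.1.1 = pos k.
Proof.
elim: m o j => [|m IH] o j.
  by rewrite arm0 endpoints_place => /mapP[u _ ->]; exists j.
rewrite armS !endpoints_cat endpoints_place !mem_cat => /or3P[|/mapP[u _ ->]|/IH[k jk ->]].
- move/endpoints_zip; rewrite mem_cat => /orP[]/mapP[u _ ->]; first by exists j.
  by exists j.+1.
- by exists j.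
- by exists k; rewrite 1?ltnW.
Qed.

Lemma ins_arm o j m : {subset map (at_ (pos j)) (ins ng d o) <= endpoints (arm o j m)}.
Proof.
have insl : {subset ins ng d o <= lendpoints (cell ng d o)}.
  by apply/allP; case: ng; case: d; case: o.
have insl' : {subset ins ng d o <= lendpoints (last_cell ng d o b)}.
  move=> v /insl vC; rewrite /last_cell /lendpoints map_cat flatten_cat mem_cat.
  by rewrite -/(lendpoints _) vC.
move=> _ /mapP[u ui ->]; case: m => [|m].
  by rewrite arm0 endpoints_place map_f ?insl'.
by rewrite armS !endpoints_cat endpoints_place !mem_cat (map_f _ (insl _ ui)) orbT.
Qed.

Lemma size_masks n m : m \in masks n -> size m = n.
Proof.
elim: n m => [|n IH] m /=; first by rewrite inE => /eqP->.
by rewrite mem_cat => /orP[]/mapP[m' /IH <- ->].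
Qed.

Lemma uniq_ins o : uniq (ins ng d o).
Proof. by case: ng; case: d; case: o. Qed.

Lemma uniq_outs o : uniq (outs ng d o).
Proof. by case: ng; case: d; case: o. Qed.

Lemma outs_cell o : {subset outs ng d o <= lendpoints (cell ng d o)}.
Proof. by apply/allP; case: ng; case: d; case: o. Qed.

Lemma size_bridge_exps : size (bridge_exps ng) = 3.
Proof. by rewrite /bridge_exps; case: ng. Qed.

Hypothesis pos_inj : injective pos.

(** Peeling off the first octagon multiplies by the transfer matrix, which advances [cheb] by one
    index; the last octagon provides the initial terms. *)
Lemma covers_arm o j m M : size M = 3 ->
  covers (arm o j m)
    (rm (endpoints (arm o j m)) (mask M (map (at_ (pos j)) (ins ng d o))))
  = amp ng x1 x2 (cheb x1 x2 m.+2) (cheb x1 x2 m.+1) M.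
Proof.
elim: m o j M => [|m IH] o j M szM.
  rewrite -map_mask arm0 endpoints_place rm_map ?covers_place ?last_cell_covers //;
    exact: at_inj.
rewrite -map_mask armS /bridge covers_cell_bridge ?size_map ?size_bridge_exps //.
- rewrite chebSS -(@cell_transfer _ _ _ _ d o) //.
  by apply: eq_big_seq => m' /size_masks szm'; rewrite IH.
- exact: uniq_outs.
- by rewrite map_inj_uniq ?uniq_ins //; apply: at_inj.
- exact: outs_cell.
- exact: ins_arm.
- move=> v /mem_endpoints_arm[k jk ->]; apply/eqP => /pos_inj kj.
  by rewrite kj ltnn in jk.
Qed.

End ArmCovers.

(** * The graphs as unions of arms *)

Section SameCovers.
Variables (R : comNzRingType) (x1 x2 : R).
Implicit Types G : wgraph R.

(** Both components together determine the matching polynomial and, unlike that polynomial alone,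
    are compatible with concatenation. *)
Definition same_covers G G' := covers G =1 covers G' /\ endpoints G =i endpoints G'.

Lemma same_covers_matching G G' : same_covers G G' -> matching_poly G = matching_poly G'.
Proof. by case=> eqc eqe; rewrite !matching_polyE eqc; apply: covers_eqi. Qed.

Lemma same_covers_trans G1 G2 G3 : same_covers G1 G2 -> same_covers G2 G3 -> same_covers G1 G3.
Proof. by move=> [c e] [c' e']; split=> v; rewrite ?c ?e. Qed.

Lemma same_covers_sym G G' : same_covers G G' -> same_covers G' G.
Proof. by case=> c e; split=> v; rewrite ?c ?e. Qed.

Lemma same_covers_perm G G' : perm_eq G G' -> same_covers G G'.
Proof.
move=> eqG; split; first exact: covers_perm.
by move=> v; apply: perm_mem; apply/perm_flatten/perm_map.
Qed.

Lemma same_covers_cat G1 G2 G1' G2' :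
  same_covers G1 G1' -> same_covers G2 G2' -> same_covers (G1 ++ G2) (G1' ++ G2').
Proof.
move=> [c1 e1] [c2 e2]; split=> v; last by rewrite !endpoints_cat !mem_cat e1 e2.
rewrite (covers_cat2l G1 c2) (covers_perm (permEl (perm_catC G1 G2'))).
by rewrite (covers_cat2l G2' c1) (covers_perm (permEl (perm_catC G2' G1'))).
Qed.

Lemma same_covers_refl G : same_covers G G.
Proof. by []. Qed.

Lemma same_covers_rev_edge a b w : same_covers [:: (a, b, w)] [:: (b, a, w)].
Proof.
split=> [U|v]; first by rewrite (covers_rev_edge _ _ _ [::]).
by rewrite !endpoints_cons !inE orbCA.
Qed.

Lemma big_union_cons i s (F : nat -> wgraph R) :
  big_union (i :: s) F = F i ++ big_union s F.
Proof. by []. Qed.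

Lemma big_union_nil (F : nat -> wgraph R) : big_union [::] F = [::].
Proof. by []. Qed.

Lemma same_covers_big_union s F F' :
  {in s, forall i, same_covers (F i) (F' i)} -> same_covers (big_union s F) (big_union s F').
Proof.
elim: s => [|i s IH] // simF; apply: same_covers_cat; first by apply: simF; rewrite mem_head.
by apply: IH => k ks; apply: simF; rewrite inE ks orbT.
Qed.

Lemma perm_big_union_cat s (F F' : nat -> wgraph R) :
  perm_eq (big_union s (fun i => F i ++ F' i)) (big_union s F ++ big_union s F').
Proof.
elim: s => [|i s IH] //; rewrite !big_union_cons.
apply/permP => p; move/permP/(_ p): IH; rewrite !count_cat; lia.
Qed.

Lemma iotaS j n : iota j n.+1 = j :: iota j.+1 n.
Proof. by []. Qed.

Lemma eq_big_union s (F F' : nat -> wgraph R) :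
  {in s, forall i, F i = F' i} -> big_union s F = big_union s F'.
Proof. by move=> eqF; congr flatten; apply/eq_in_map. Qed.

(* The edges of [bridge], as oriented and ordered in the definition of the graphs. *)
Definition links ng d o i j : wgraph R :=
  Defs.connect x2 (if d then j else i) (if d then i else j) (o (+) ng)
  ++ [:: Defs.arc R (at_ i (turn d o (arc_corner ng)))
                    (at_ j (turn d (~~ o) (arc_corner ng)))].

Lemma same_covers_links ng d o i j : same_covers (links ng d o i j) (bridge x1 x2 ng d o i j).
Proof.
have x00 : xmon x1 x2 (0, 0)%N = 1 by rewrite /xmon !expr0 mulr1.
have x01 : xmon x1 x2 (0, 1)%N = x2 by rewrite /xmon expr0 expr1 mul1r.
pose rev (b : bool) (e : wedge R) := if b then (e.1.2, e.1.1, e.2) else e.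
have sim3' b e1 e2 e3 : same_covers [:: e1; e2; e3] [:: rev b e1; rev b e2; e3].
  case: b => //; case: e1 e2 => [[a1 b1] w1] [[a2 b2] w2].
  apply: (@same_covers_cat [:: _] [:: _; _] [:: _] [:: _; _]).
    exact: same_covers_rev_edge.
  by apply: (@same_covers_cat [:: _] [:: _] [:: _] [:: _]) => //; apply: same_covers_rev_edge.
have sim3 b e1 e2 e3 : same_covers [:: e1; e2; e3] [:: rev b e2; rev b e1; e3].
  apply: (same_covers_trans (G2 := [:: e2; e1; e3])); last exact: sim3'.
  by apply: same_covers_perm; rewrite (perm_catCA [:: e1] [:: e2] [:: e3]).
(* [connect] lists the top edge first, while the bridge starts with the bottom one unless [o]; when
   [d] holds these two edges also have the opposite orientation. *)
case: o; [have := sim3' d|have := sim3 d]; case: ng; case: d => sim;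
  by rewrite /bridge /= ?x00 ?x01; apply: sim.
Qed.

Section Arm.
Variables (ng d b : bool) (pos : nat -> int) (o : nat -> bool) (A : wgraph R).
Variable f : int -> side -> bool.
Hypothesis o_alt : forall i, o i.+1 = ~~ o i.

Definition end_square := if ng then [::] else squareL (if d then West else East) b.

Lemma arm_perm j m :
  perm_eq (arm x1 x2 ng d b pos (o j) j m)
    (big_union (iota j m.+1) (fun i => place x1 x2 (at_ (pos i)) (cell ng d (o i)))
     ++ big_union (iota j m) (fun i => bridge x1 x2 ng d (o i) (pos i) (pos i.+1))
     ++ place x1 x2 (at_ (pos (j + m)%N)) end_square).
Proof.
elim: m j => [|m IH] j.
  by rewrite arm0 !big_union_cons !big_union_nil cats0 addn0 -map_cat.
rewrite armS; have := IH j.+1.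
rewrite o_alt addSnnS => /permP eqp; apply/permP => p; move: {eqp}(eqp p).
rewrite !iotaS !(big_union_cons j) !count_cat; lia.
Qed.

(** The arcs [A] influence the octagons and squares only through the position of x_2 in each square;
    the hypothesis says that it is the position built into [cell]. *)
Lemma same_covers_arm j m :
    (forall i, (j <= i <= j + m)%N ->
      x2_first A f (pos i) (if o i then South else North) = ng (+) d) ->
  same_covers
    (big_union (iota j m.+1) (fun i =>
       octagon x1 (pos i) ++ attach x2 A f (pos i) (if o i then South else North))
     ++ big_union (iota j m) (fun i => links ng d (o i) (pos i) (pos i.+1))
     ++ place x1 x2 (at_ (pos (j + m)%N)) end_square)
    (arm x1 x2 ng d b pos (o j) j m).
Proof.
move=> x2A; apply: same_covers_trans (same_covers_sym (same_covers_perm (arm_perm j m))).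
apply: same_covers_cat; last first.
  by apply: same_covers_cat => //; apply: same_covers_big_union => i _; apply: same_covers_links.
apply: same_covers_big_union => i; rewrite mem_iota addnS ltnS => /x2A x2i.
by rewrite (octagonE _ x2) (attachE x1) x2i -map_cat.
Qed.

End Arm.

Lemma has_arcs (v : nat -> vertex) w j n :
  has (incident w) [seq Defs.arc R (v i) (v i.+1) | i <- iota j n.+1]
  = has (fun i => w == v i) (iota j n.+2).
Proof.
elim: n j => [|n IH] j; first by rewrite /= /incident /= !orbF.
rewrite iotaS map_cons [has _ (_ :: _)]/has -/(has _ _) IH /= /incident /= -!orbA.
by case: (w == v j); case: (w == v j.+1).
Qed.

Lemma has_arcs_none (v : nat -> vertex) w s :
  (forall i, w != v i) -> (forall i, w != v i.+1) ->
  has (incident w) [seq Defs.arc R (v i) (v i.+1) | i <- s] = false.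
Proof.
move=> nv nv'; apply/negP => /hasP[_ /mapP[i _ ->]].
by rewrite /incident /= (negPf (nv i)) (negPf (nv' i)).
Qed.

Lemma has_arcs_at (v : nat -> vertex) i j n : (j <= i <= j + n.+1)%N ->
  has (incident (v i)) [seq Defs.arc R (v i) (v i.+1) | i <- iota j n.+1].
Proof.
move=> ij; rewrite has_arcs; apply/hasP; exists i => //.
by rewrite mem_iota; lia.
Qed.

Lemma matching_G_3 : matching_poly (G_3 x2) = 1 + x2.
Proof.
have -> : G_3 x2 = place x1 x2 (at_ 0)
    [:: (NL, false, (NR, false), (0, 1)); (NR, false, (SR, false), (0, 0));
        (SR, false, (SL, false), (0, 0)); (SL, false, (NL, false), (0, 0))]%N.
  by rewrite /place /xmon /= !expr0 expr1 mulr1 mul1r.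
rewrite matching_polyE endpoints_place covers_place; last exact: at_inj.
by evaluate; ring.
Qed.

End SameCovers.

(** * Graphs of odd index, and the smallest graphs of even index *)

Section OneArm.
Variables (R : comNzRingType) (x1 x2 : R).

Lemma place_cat (V W : eqType) (h : V -> W) (G1 G2 : seq (V * V * (nat * nat))) :
  place x1 x2 h (G1 ++ G2) = place x1 x2 h G1 ++ place x1 x2 h G2.
Proof. exact: map_cat. Qed.

Section X2First.
Variables (A : wgraph R) (f : int -> side -> bool) (i : int) (s : side).

Lemma x2_first_none :
    has (incident (old i (ends s).1)) A = false ->
    has (incident (old i (ends s).2)) A = false ->
  x2_first A f i s = f i s.
Proof. by rewrite /x2_first; case: (ends s) => p q /= -> ->. Qed.

Lemma x2_first_left : has (incident (old i (ends s).1)) A -> x2_first A f i s = false.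
Proof. by rewrite /x2_first; case: (ends s) => p q /= ->. Qed.

Lemma x2_first_right :
    has (incident (old i (ends s).1)) A = false ->
    has (incident (old i (ends s).2)) A ->
  x2_first A f i s = true.
Proof. by rewrite /x2_first; case: (ends s) => p q /= -> ->. Qed.

End X2First.

(** For G_(2k+3) with k >= 2, the octagon O_1 carries an end square on the side away from the arm;
    pairing it with the amplitudes of the arm closes the chain. *)
Lemma odd_head b u v :
  \sum_(m <- masks 3)
     msum x1 x2 (bridge_covers (cell false true true ++ squareL East b) [::]
             (outs false true true) (bridge_exps false) m) * amp false x1 x2 u v m
  = (1 + x2) * ((x1 ^+ 4 + (1 + x2) ^+ 2) * u - x1 ^+ 4 * x2 ^+ 2 * v) - x1 ^+ 4 * x2 * u.
Proof. by rewrite sum_amp; case: b; evaluate; ring. Qed.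

Lemma matching_arm ng d b pos o j m : injective pos ->
  matching_poly (arm x1 x2 ng d b pos o j m)
  = amp ng x1 x2 (cheb x1 x2 m.+2) (cheb x1 x2 m.+1) [:: false; false; false].
Proof.
move=> injp; rewrite -(@covers_arm _ x1 x2 ng d b pos injp o j m) // matching_polyE.
by apply: covers_eqi => v; rewrite mem_rm.
Qed.

(** The vertices [S] of the head may be matched elsewhere, which leaves room for a second arm. *)
Lemma covers_head ng d b o pos i j m (G : lgraph) S (L := bridge x1 x2 ng d o i (pos j)
    ++ place x1 x2 (at_ i) G ++ arm x1 x2 ng d b pos (~~ o) j m) :
    injective pos -> (forall k, (j <= k)%N -> pos k != i) ->
    {subset outs ng d o <= lendpoints G} ->
  covers L (rm (endpoints L) (map (at_ i) S))
  = \sum_(k <- masks 3) msum x1 x2 (bridge_covers G S (outs ng d o) (bridge_exps ng) k)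
       * amp ng x1 x2 (cheb x1 x2 m.+2) (cheb x1 x2 m.+1) k.
Proof.
move=> injp posi oG; rewrite /L /bridge covers_cell_bridge ?size_map ?size_bridge_exps //.
- by apply: eq_big_seq => k /size_masks szk; rewrite covers_arm.
- exact: uniq_outs.
- by rewrite map_inj_uniq ?uniq_ins //; apply: at_inj.
- exact: ins_arm.
- by move=> v /mem_endpoints_arm[k jk ->]; apply: posi.
Qed.

Lemma matching_head ng d b o pos i j m (G : lgraph) :
    injective pos -> (forall k, (j <= k)%N -> pos k != i) ->
    {subset outs ng d o <= lendpoints G} ->
  matching_poly (bridge x1 x2 ng d o i (pos j) ++ place x1 x2 (at_ i) G
                 ++ arm x1 x2 ng d b pos (~~ o) j m)
  = \sum_(k <- masks 3) msum x1 x2 (bridge_covers G [::] (outs ng d o) (bridge_exps ng) k)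
       * amp ng x1 x2 (cheb x1 x2 m.+2) (cheb x1 x2 m.+1) k.
Proof.
move=> injp posi oG; rewrite -(@covers_head ng d b o pos i j m G [::]) //.
by rewrite rm_nil matching_polyE.
Qed.

Lemma matching_place i (G : lgraph) :
  matching_poly (place x1 x2 (at_ i) G) = msum x1 x2 (lcovers G (lendpoints G)).
Proof. by rewrite matching_polyE endpoints_place covers_place //; apply: at_inj. Qed.

Lemma perm_odd_pos (T : eqType) (X1 X E W L1 L K A : seq T) :
  perm_eq (L1 ++ L) (K ++ A) ->
  perm_eq ((X1 ++ X) ++ E ++ W ++ K ++ A) (L1 ++ (X1 ++ E) ++ X ++ L ++ W).
Proof.
by move=> /permP eqp; apply/permP => p; have := eqp p; rewrite !count_cat; lia.
Qed.

Lemma matching_odd_pos_long m f :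
  matching_poly (G_odd_pos x1 x2 f m.+2)
  = (1 + x2) * cheb x1 x2 m.+3 - x1 ^+ 4 * x2 * cheb x1 x2 m.+2.
Proof.
pose v (i : nat) := old i (if odd i then SR else NR).
pose A : wgraph R := [seq Defs.arc R (v i) (v i.+1) | i <- iota 1 m.+1].
have noA i c : c \notin [:: SR; NR] -> has (incident (old i c)) A = false.
  move=> cn; apply: has_arcs_none => k; apply: contra cn => /eqP[_ ->];
    by case: ifP; rewrite !inE eqxx ?orbT.
(* Each of these squares meets an arc at its right corner and none at its left corner, so x_2 is
   forced to the left. *)
have x2A i : (1 <= i <= m.+2)%N -> x2_first A f i (if odd i then South else North) = true.
  move=> im; have: has (incident (v i)) A := has_arcs_at R v im.
  by rewrite /v; case: (odd i) => vA; rewrite x2_first_right // noA.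
have AE i : x2_first A f i East = f i East by rewrite x2_first_none ?noA.
have AW i : x2_first A f i West = f i West by rewrite x2_first_none ?noA.
(* The head is O_1, and O_2, ..., O_(m+2) form an arm leaving to the left. *)
have sim : same_covers (G_odd_pos x1 x2 f m.+2)
   (bridge x1 x2 false true (odd 1) 1%:Z 2%:Z
    ++ place x1 x2 (at_ 1%:Z) (cell false true (odd 1) ++ squareL East (f 1%:Z East))
    ++ arm x1 x2 false true (f m.+2 West) Posz (odd 2) 2 m).
  have simA := @same_covers_arm _ x1 x2 false true (f m.+2 West) Posz odd A f (fun i => erefl) 2 m.
  apply: same_covers_trans (same_covers_cat
    (same_covers_links x1 x2 false true (odd 1) 1%:Z 2%:Z)
    (same_covers_cat (same_covers_refl _) (simA _))); last first.
    by move=> i im; apply: x2A; lia.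
  have -> : G_odd_pos x1 x2 f m.+2 =
      big_union (iota 1 m.+2) (fun i =>
        octagon x1 i ++ attach x2 A f i (if odd i then South else North))
      ++ attach x2 A f 1%:Z East ++ attach x2 A f m.+2 West
      ++ big_union (iota 1 m.+1) (fun i => Defs.connect x2 i.+1 i (odd i)) ++ A by [].
  have AU : A = big_union (iota 1 m.+1) (fun i => [:: Defs.arc R (v i) (v i.+1)]).
    by rewrite /big_union flatten_map1.
  have lE : {in iota 1 m.+1, forall i : nat, links x2 false true (odd i) i i.+1 =
      Defs.connect x2 i.+1 i (odd i) ++ [:: Defs.arc R (v i) (v i.+1)]}.
    by move=> i _; rewrite /links addbF /v /=; case: (odd i).
  have := perm_big_union_cat (iota 1 m.+1) (fun i => Defs.connect x2 i.+1 i (odd i))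
             (fun i => [:: Defs.arc R (v i) (v i.+1)]).
  rewrite -AU -(eq_big_union lE) => plE.
  rewrite /end_square -(AW m.+2%:Z) -(AE 1%:Z) place_cat.
  rewrite -!(attachE _ _ A).
  have -> : place x1 x2 (at_ 1%:Z) (cell false true (odd 1)) =
      octagon x1 1%:Z ++ attach x2 A f 1%:Z (if odd 1 then South else North).
    by rewrite (octagonE _ x2) (attachE x1) (x2A 1%N) // -map_cat.
  apply: same_covers_perm; apply: perm_odd_pos; exact: plE.
rewrite (same_covers_matching sim) (@matching_head false true _ true Posz 1%:Z 2 m) //.
- by rewrite odd_head chebSS.
- by move=> k l [].
- by move=> k; apply: contraTneq => -[->].
- by apply/allP; case: (f 1 East).
Qed.

Lemma matching_odd_pos_1 f :
  matching_poly (G_odd_pos x1 x2 f 1) = (1 + x2) * cheb x1 x2 2 - x1 ^+ 4 * x2 * cheb x1 x2 1.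
Proof.
have -> : G_odd_pos x1 x2 f 1 =
    ((octagon x1 1 ++ attach x2 [::] f 1 South) ++ [::])
    ++ attach x2 [::] f 1 East ++ attach x2 [::] f 1 West ++ [::] by [].
rewrite !cats0 !(attachE x1) (octagonE _ x2) !x2_first_none // -!place_cat matching_place.
by case: (f 1 South); case: (f 1 East); case: (f 1 West); rewrite !chebSS; evaluate; ring.
Qed.

Lemma matching_odd_neg_1 f :
  matching_poly (G_odd_neg x1 x2 f 1) = cheb x1 x2 2 - x2 * (1 + x2) * cheb x1 x2 1.
Proof.
have -> : G_odd_neg x1 x2 f 1 =
    ((octagon x1 1 ++ attach x2 [::] f 1 North) ++ [::]) ++ [::] by [].
rewrite !cats0 (attachE x1) (octagonE _ x2) x2_first_none // -!place_cat matching_place.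
by case: (f 1 North); rewrite !chebSS; evaluate; ring.
Qed.

Lemma matching_odd_neg_long m f :
  matching_poly (G_odd_neg x1 x2 f m.+2) = cheb x1 x2 m.+3 - x2 * (1 + x2) * cheb x1 x2 m.+2.
Proof.
pose v (i : nat) := old i (if odd i then NL else SL).
pose A : wgraph R := [seq Defs.arc R (v i) (v i.+1) | i <- iota 1 m.+1].
pose o i := ~~ odd i.
have x2A i : (1 <= i <= m.+2)%N -> x2_first A f i (if o i then South else North) = false.
  move=> im; have: has (incident (v i)) A := has_arcs_at R v im.
  by rewrite /v /o; case: (odd i) => vA; rewrite x2_first_left.
(* Without end square at O_1, the whole graph is a single arm leaving to the left. *)
have sim : same_covers (G_odd_neg x1 x2 f m.+2) (arm x1 x2 true true true Posz (o 1%N) 1 m.+1).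
  apply: same_covers_trans
    (@same_covers_arm _ x1 x2 true true _ Posz o A f (fun i => erefl) 1 m.+1 x2A).
  have -> : G_odd_neg x1 x2 f m.+2 =
      big_union (iota 1 m.+2) (fun i =>
        octagon x1 i ++ attach x2 A f i (if odd i then North else South))
      ++ big_union (iota 1 m.+1) (fun i => Defs.connect x2 i.+1 i (odd i)) ++ A by [].
  have AU : A = big_union (iota 1 m.+1) (fun i => [:: Defs.arc R (v i) (v i.+1)]).
    by rewrite /big_union flatten_map1.
  have lE : {in iota 1 m.+1, forall i : nat, links x2 true true (o i) i i.+1 =
      Defs.connect x2 i.+1 i (odd i) ++ [:: Defs.arc R (v i) (v i.+1)]}.
    by move=> i _; rewrite /links /o /v /=; case: (odd i).
  have cE : {in iota 1 m.+2, forall i : nat,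
      octagon x1 i ++ attach x2 A f i (if o i then South else North) =
      octagon x1 i ++ attach x2 A f i (if odd i then North else South)}.
    by move=> i _; rewrite /o; case: (odd i).
  rewrite (eq_big_union lE) (eq_big_union cE) cats0.
  apply: same_covers_cat => //; apply: same_covers_sym; apply: same_covers_perm.
  by rewrite AU; apply: perm_big_union_cat.
by rewrite (same_covers_matching sim) matching_arm // => i j [].
Qed.

Lemma matching_even_pos_1 f :
  matching_poly (G_even_pos x1 x2 f 1) = (1 + x2) ^+ 4 + x1 ^+ 4.
Proof.
have -> : G_even_pos x1 x2 f 1 =
    octagon x1 0 ++ attach x2 [::] f 0 North ++ attach x2 [::] f 0 South
    ++ attach x2 [::] f 0 East ++ attach x2 [::] f 0 West ++ [::] by [].
rewrite !cats0 !(attachE x1) (octagonE _ x2) !x2_first_none // -!place_cat matching_place.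
by case: (f 0 North); case: (f 0 South); case: (f 0 East); case: (f 0 West); evaluate; ring.
Qed.

Lemma matching_even_neg_1 f : matching_poly (G_even_neg x1 x2 f 1) = 1 + x1 ^+ 4.
Proof.
have -> : G_even_neg x1 x2 f 1 = octagon x1 0 ++ [::] by [].
by rewrite cats0 (octagonE _ x2) matching_place; evaluate; ring.
Qed.

End OneArm.

(** * Two arms attached to a central octagon *)

Section TwoArms.
Variables (R : comNzRingType) (x1 x2 : R).

(** The two weights x_2 avoid the arcs, which leave O_0 at [NR] and [SL] when it has squares. *)
Definition center ng : lgraph :=
  octagonL ++ (if ng then [::] else squareL North true ++ squareL South false).

(** The sum is a bilinear form in the amplitudes of the right arm (mask [k]) and of the left arm
    (mask [l]). It is a product of two consecutive values of odd index, corrected by the quadratic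
    invariant [inv] of the recurrence. *)
Lemma center_sum ng u v (u' := (x1 ^+ 4 + (1 + x2) ^+ 2) * u - x1 ^+ 4 * x2 ^+ 2 * v)
    (inv := u ^+ 2 - (x1 ^+ 4 + (1 + x2) ^+ 2) * u * v + x1 ^+ 4 * x2 ^+ 2 * v ^+ 2) :
  \sum_(k <- masks 3)
     (wprod k (map (xmon x1 x2) (bridge_exps ng)) *
      \sum_(l <- masks 3) msum x1 x2 (bridge_covers (center ng) (mask k (outs ng false true))
                                   (outs ng true false) (bridge_exps ng) l) * amp ng x1 x2 u v l)
     * amp ng x1 x2 u v k
  = if ng then (u' - x2 * (1 + x2) * u) * (u - x2 * (1 + x2) * v) - x2 * inv
    else ((1 + x2) * u' - x1 ^+ 4 * x2 * u) * ((1 + x2) * u - x1 ^+ 4 * x2 * v)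
         - x1 ^+ 4 * x2 * inv.
Proof.
pose F k l := msum x1 x2 (bridge_covers (center ng) (mask k (outs ng false true))
                            (outs ng true false) (bridge_exps ng) l).
rewrite (eq_bigr _ (fun k _ => congr1 (fun z => wprod k _ * z * amp ng x1 x2 u v k)
  (sum_amp ng x1 x2 (F k) u v))) sum_amp {}/F.
rewrite {}/inv {}/u' !wprod_xmon.
by case: ng; evaluate; ring.
Qed.

(** This and the next value will be p_(2k+3) for k >= 0 and p_(1-2k) for k >= 1. *)
Definition odd_pos_value k := (1 + x2) * cheb x1 x2 k.+1 - x1 ^+ 4 * x2 * cheb x1 x2 k.
Definition odd_neg_value k := cheb x1 x2 k.+1 - x2 * (1 + x2) * cheb x1 x2 k.

(** These will be p_(-2k) when [ng] holds and p_(2k+4) otherwise: the terms y_k y_(k+1) - 1 after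
    clearing denominators, the subtracted monomial being the common denominator. *)
Definition even_value (ng : bool) k : R :=
  if ng then odd_neg_value k.+1 * odd_neg_value k - x2 * (x1 ^+ 4 * x2 ^+ 2) ^+ k
  else odd_pos_value k.+1 * odd_pos_value k - x1 ^+ 4 * x2 * (x1 ^+ 4 * x2 ^+ 2) ^+ k.

(** The quadratic form attached to the linear recurrence is multiplied at each step by the
    coefficient x_1^4 x_2^2. *)
Lemma cheb_invariant k :
  cheb x1 x2 k.+1 ^+ 2 - (x1 ^+ 4 + (1 + x2) ^+ 2) * cheb x1 x2 k.+1 * cheb x1 x2 k
    + x1 ^+ 4 * x2 ^+ 2 * cheb x1 x2 k ^+ 2 = (x1 ^+ 4 * x2 ^+ 2) ^+ k.
Proof.
elim: k => [|k IH]; first by rewrite /=; ring.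
by rewrite [RHS]exprS -IH chebSS; ring.
Qed.

Definition negz (i : nat) : int := - i%:Z.

Lemma negz_inj : injective negz.
Proof. by move=> i j /oppr_inj[]. Qed.

Lemma outs_center ng d o : {subset outs ng d o <= lendpoints (center ng)}.
Proof. by apply/allP; case: ng; case: d; case: o. Qed.

Lemma matching_two_arms ng bR bL m :
  matching_poly
    (bridge x1 x2 ng false true 0 1%:Z
     ++ (bridge x1 x2 ng true false 0 (negz 1) ++ place x1 x2 (at_ 0) (center ng)
         ++ arm x1 x2 ng true bL negz true 1 m)
     ++ arm x1 x2 ng false bR Posz false 1 m)
  = even_value ng m.+1.
Proof.
set AR := arm x1 x2 ng false bR Posz false 1 m.
set GL := bridge _ _ _ _ _ _ (negz 1) ++ _.
(* The sign of the octagon index separates the right arm from the center with its left arm. *)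
have posR v : v \in endpoints AR -> 0 < v.1.1.
  by move=> /mem_endpoints_arm[k k0 ->].
have nposL v : v \in endpoints GL -> v.1.1 <= 0.
  rewrite !endpoints_cat endpoints_place !mem_cat => /or3P[/endpoints_zip||].
  - by rewrite mem_cat => /orP[]/mapP[u _ ->]; rewrite /= ?lexx ?oppr_le0.
  - by case/mapP => u _ ->; rewrite lexx.
  - by move=> /mem_endpoints_arm[k k0 ->]; rewrite oppr_le0.
have outsGL : {subset map (at_ 0) (outs ng false true) <= endpoints GL}.
  move=> _ /mapP[u uo ->].
  by rewrite !endpoints_cat endpoints_place !mem_cat map_f ?orbT //; apply: outs_center uo.
have insAR := @ins_arm R x1 x2 ng false bR Posz false 1 m.
rewrite matching_polyE.
have -> : covers (bridge x1 x2 ng false true 0 1%:Z ++ GL ++ AR)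
             (endpoints (bridge x1 x2 ng false true 0 1%:Z ++ GL ++ AR))
   = covers (bridge x1 x2 ng false true 0 1%:Z ++ GL ++ AR) (endpoints GL ++ endpoints AR).
  apply: covers_eqi => v; rewrite (endpoints_cat _ (GL ++ AR)) (endpoints_cat GL) !mem_cat.
  case vGA: ((v \in endpoints GL) || (v \in endpoints AR)); first by rewrite orbT.
  rewrite orbF; apply: contraFF vGA => /endpoints_zip.
  by rewrite mem_cat => /orP[/outsGL|/insAR] ->; rewrite ?orbT.
rewrite covers_bridge ?size_map ?size_bridge_exps //.
- rewrite /even_value -cheb_invariant /odd_pos_value /odd_neg_value !chebSS -center_sum.
  apply: eq_big_seq => k /size_masks szk.
  rewrite covers_arm //; last by move=> i j [].
  have -> : all (mem (endpoints GL)) (mask k (map (at_ 0) (outs ng false true))).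
    by apply/allP => v /mem_mask /outsGL.
  (* The vertices of the center used by the right bridge are those that the head of the left arm
     leaves to be matched elsewhere. *)
  congr (_ * _ * _); rewrite -map_mask covers_head //; first exact: negz_inj.
    by case.
  exact: outs_center.
- by rewrite map_inj_uniq ?uniq_outs //; apply: at_inj.
- by rewrite map_inj_uniq ?uniq_ins //; apply: at_inj.
- by move=> v /outsGL /nposL; rewrite leNgt; apply/contra => /posR.
- by move=> v /posR; rewrite ltNge; apply/contra => /nposL.
- by move=> v /posR; rewrite ltNge; apply/contra => /nposL.
- by move=> v /nposL; rewrite leNgt; apply/contra => /posR.
Qed.

End TwoArms.

(** * Graphs of even index as two arms around O_0 *)

Section EvenGraphs.
Variables (R : comNzRingType) (x1 x2 : R).

Lemma perm_two_arms (T : eqType) (C XR XL LR1 LR LL1 LL ER EL : seq T) :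
  perm_eq (C ++ XR ++ XL ++ (LR1 ++ LR) ++ (LL1 ++ LL) ++ ER ++ EL)
    (LR1 ++ (LL1 ++ C ++ XL ++ LL ++ EL) ++ XR ++ LR ++ ER).
Proof. by apply/permP => p; rewrite !count_cat; lia. Qed.

(** The center counts as the octagon of index 0 of both arms, so the bridges leaving it are the
    terms of index 0 in the unions of [links]. *)
Lemma same_covers_two_arms ng f m (A : wgraph R) bR bL :
    (forall i : nat, (1 <= i <= m.+1)%N ->
       x2_first A f i (if ~~ odd i then South else North) = ng) ->
    (forall i : nat, (1 <= i <= m.+1)%N ->
       x2_first A f (negz i) (if odd i then South else North) = ~~ ng) ->
  same_covers
    (place x1 x2 (at_ 0) (center ng)
     ++ big_union (iota 1 m.+1) (fun i =>
          octagon x1 i ++ attach x2 A f i (if ~~ odd i then South else North))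
     ++ big_union (iota 1 m.+1) (fun i =>
          octagon x1 (negz i) ++ attach x2 A f (negz i) (if odd i then South else North))
     ++ big_union (iota 0 m.+1) (fun i => links x2 ng false (~~ odd i) i i.+1)
     ++ big_union (iota 0 m.+1) (fun i => links x2 ng true (odd i) (negz i) (negz i.+1))
     ++ place x1 x2 (at_ m.+1) (end_square ng false bR)
     ++ place x1 x2 (at_ (negz m.+1)) (end_square ng true bL))
    (bridge x1 x2 ng false true 0 1%:Z
     ++ (bridge x1 x2 ng true false 0 (negz 1) ++ place x1 x2 (at_ 0) (center ng)
         ++ arm x1 x2 ng true bL negz true 1 m)
     ++ arm x1 x2 ng false bR Posz false 1 m).
Proof.
move=> x2R x2L.
have simR := @same_covers_arm _ x1 x2 ng false bR Posz (fun i => ~~ odd i) A f (fun i => erefl) 1 m.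
have simL := @same_covers_arm _ x1 x2 ng true bL negz odd A f (fun i => erefl) 1 m.
apply: same_covers_trans (same_covers_cat (same_covers_links x1 x2 ng false true 0 1%:Z)
  (same_covers_cat (same_covers_cat (same_covers_links x1 x2 ng true false 0 (negz 1))
     (same_covers_cat (same_covers_refl (place x1 x2 (at_ 0) (center ng))) (simL _))) (simR _))).
- exact/same_covers_perm/perm_two_arms.
- by move=> i /x2L ->; rewrite addbT.
- by move=> i /x2R ->; rewrite addbF.
Qed.

Lemma big_union_shift n (F : nat -> wgraph R) :
  big_union (iota 1 n) F = big_union (iota 0 n) (fun i => F i.+1).
Proof. by rewrite /big_union (iotaDl 1 0) -map_comp. Qed.

Lemma perm_even_union s (F1 F2 F3 F4 F5 F6 : nat -> wgraph R) :
  perm_eq (big_union s (fun i => F1 i ++ F2 i ++ F3 i ++ F4 i ++ F5 i ++ F6 i))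
    (big_union s (fun i => F1 i ++ F2 i) ++ big_union s (fun i => F3 i ++ F4 i)
     ++ big_union s F5 ++ big_union s F6).
Proof.
elim: s => // i s IH; rewrite !big_union_cons; apply/permP => p.
by move/permP/(_ p): IH; rewrite !count_cat; lia.
Qed.

Lemma perm_even (T : eqType) (C BU E W A1 A2 XR XL KR KL LR LL : seq T) :
    perm_eq BU (XR ++ XL ++ KR ++ KL) -> perm_eq LR (KR ++ A1) -> perm_eq LL (KL ++ A2) ->
  perm_eq (C ++ BU ++ E ++ W ++ A1 ++ A2) (C ++ XR ++ XL ++ LR ++ LL ++ E ++ W).
Proof.
move=> /permP eq1 /permP eq2 /permP eq3; apply/permP => p.
by move: (eq1 p) (eq2 p) (eq3 p); rewrite !count_cat; lia.
Qed.

Lemma arcs_shift (v : nat -> vertex) n :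
  [seq Defs.arc R (v i.-1) (v i) | i <- iota 1 n] =
  [seq Defs.arc R (v i) (v i.+1) | i <- iota 0 n].
Proof. by rewrite (iotaDl 1 0) -map_comp. Qed.

Lemma old_neq i c j c' : (c != c') || (i != j) -> old i c != old j c'.
Proof. by apply: contraTneq => -[-> ->]; rewrite !eqxx. Qed.

Lemma negz_neq i k : (0 < i)%N -> negz i != k%:Z.
Proof. by case: i. Qed.

Lemma pos_neq_negz i k : (0 < i)%N -> i%:Z != negz k.
Proof. by case: i k => [|i] [|k]. Qed.

Definition right_arc_end ng (j : nat) := at_ j (turn false (~~ odd j) (arc_corner ng)).
Definition left_arc_end ng (j : nat) := at_ (negz j) (turn true (odd j) (arc_corner ng)).

Definition even_arcs ng m : wgraph R :=
  [seq Defs.arc R (right_arc_end ng i) (right_arc_end ng i.+1) | i <- iota 0 m.+1]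
  ++ [seq Defs.arc R (left_arc_end ng i) (left_arc_end ng i.+1) | i <- iota 0 m.+1].

Section EvenArcs.
Variables (ng : bool) (m : nat) (f : int -> side -> bool).
Local Notation A := (even_arcs ng m).

Lemma has_even_arcs_none i c :
    (forall k, old i c != right_arc_end ng k) -> (forall k, old i c != left_arc_end ng k) ->
  has (incident (old i c)) A = false.
Proof. by move=> nv nu; rewrite has_cat !has_arcs_none. Qed.

Lemma has_right_arc i : (i <= m.+1)%N -> has (incident (right_arc_end ng i)) A.
Proof. by move=> im; rewrite has_cat (@has_arcs_at R (right_arc_end ng) i 0 m im). Qed.

Lemma has_left_arc i : (i <= m.+1)%N -> has (incident (left_arc_end ng i)) A.
Proof. by move=> im; rewrite has_cat (@has_arcs_at R (left_arc_end ng) i 0 m im) orbT. Qed.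

(** The only corner of the octagon met by arcs is [right_arc_end ng i], an end of its square, which
    forces the position of x_2. *)
Lemma x2_first_right_arm (i : nat) : (1 <= i <= m.+1)%N ->
  x2_first A f i (if ~~ odd i then South else North) = ng.
Proof.
move=> /andP[i0 im].
have none c : c \notin [:: (right_arc_end ng i).1.2] -> has (incident (old i c)) A = false.
  rewrite inE => cv; apply: has_even_arcs_none => k; apply: old_neq; last first.
    by rewrite pos_neq_negz ?orbT.
  have [<-|ik] := eqVneq i k; first by rewrite cv.
  by rewrite orbC eqz_nat ik.
move: (has_right_arc im) none; rewrite /right_arc_end.
case: ng; case: (odd i) => vA none;
  by first [exact: x2_first_left | apply: x2_first_right => //; apply: none].
Qed.

Lemma x2_first_left_arm (i : nat) : (1 <= i <= m.+1)%N ->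
  x2_first A f (negz i) (if odd i then South else North) = ~~ ng.
Proof.
move=> /andP[i0 im].
have none c : c \notin [:: (left_arc_end ng i).1.2] -> has (incident (old (negz i) c)) A = false.
  rewrite inE => cv; apply: has_even_arcs_none => k; apply: old_neq.
    by rewrite negz_neq ?orbT.
  have [<-|ik] := eqVneq i k; first by rewrite cv.
  by rewrite orbC (inj_eq negz_inj) ik.
move: (has_left_arc im) none; rewrite /left_arc_end.
case: ng; case: (odd i) => vA none;
  by first [exact: x2_first_left | apply: x2_first_right => //; apply: none].
Qed.

End EvenArcs.

Lemma matching_even ng f m bR bL (A := even_arcs ng m) :
  matching_poly
    (place x1 x2 (at_ 0) (center ng)
     ++ big_union (iota 1 m.+1) (fun i =>
          octagon x1 i ++ attach x2 A f i (if odd i then North else South)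
          ++ octagon x1 (- i%:Z) ++ attach x2 A f (- i%:Z) (if odd i then South else North)
          ++ Defs.connect x2 (i%:Z - 1) i (odd i (+) ng)
          ++ Defs.connect x2 (- i%:Z) (- i%:Z + 1) (~~ odd i (+) ng))
     ++ place x1 x2 (at_ m.+1) (end_square ng false bR)
     ++ place x1 x2 (at_ (negz m.+1)) (end_square ng true bL) ++ A)
  = even_value x1 x2 ng m.+1.
Proof.
have sim := same_covers_two_arms bR bL (@x2_first_right_arm ng m f) (@x2_first_left_arm ng m f).
rewrite -(matching_two_arms _ _ _ bR bL) -(same_covers_matching sim).
apply/same_covers_matching/same_covers_perm; apply: perm_even.
- rewrite -(eq_big_union (F := fun i : nat =>
    octagon x1 i ++ attach x2 A f i (if ~~ odd i then South else North)
    ++ octagon x1 (- i%:Z) ++ attach x2 A f (- i%:Z) (if odd i then South else North)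
    ++ Defs.connect x2 (i%:Z - 1) i (odd i (+) ng)
    ++ Defs.connect x2 (- i%:Z) (- i%:Z + 1) (~~ odd i (+) ng))).
    exact: perm_even_union.
  by move=> i _; case: (odd i).
- have -> : big_union (iota 0 m.+1) (fun i => links x2 ng false (~~ odd i) i i.+1) =
      big_union (iota 0 m.+1) (fun i => Defs.connect x2 (i.+1%:Z - 1) i.+1 (odd i.+1 (+) ng)
        ++ [:: Defs.arc R (right_arc_end ng i) (right_arc_end ng i.+1)]).
    apply: eq_big_union => i _; have -> : i.+1%:Z - 1 = i by lia.
    by rewrite /links /right_arc_end.
  by rewrite big_union_shift -[X in _ ++ X]flatten_map1; apply: perm_big_union_cat.
- have -> : big_union (iota 0 m.+1) (fun i => links x2 ng true (odd i) (negz i) (negz i.+1)) =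
      big_union (iota 0 m.+1) (fun i =>
        Defs.connect x2 (- i.+1%:Z) (- i.+1%:Z + 1) (~~ odd i.+1 (+) ng)
        ++ [:: Defs.arc R (left_arc_end ng i) (left_arc_end ng i.+1)]).
    apply: eq_big_union => i _; have -> : - i.+1%:Z + 1 = negz i by rewrite /negz; lia.
    by rewrite /links /left_arc_end /= negbK.
  by rewrite big_union_shift -[X in _ ++ X]flatten_map1; apply: perm_big_union_cat.
Qed.

Lemma matching_even_pos_long m f :
  matching_poly (G_even_pos x1 x2 f m.+2) = even_value x1 x2 false m.+1.
Proof.
(* No arc meets the end squares, so their bits are those chosen by [f]. *)
rewrite -(matching_even false f m (f m.+1 East) (f (negz m.+1) West)).
set A := even_arcs false m.
pose v (j : nat) := old j (if odd j then NL else SL).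
pose u (j : nat) := old (negz j) (if odd j then SR else NR).
have vE : right_arc_end false =1 v by move=> j; rewrite /right_arc_end /v; case: (odd j).
have uE : left_arc_end false =1 u by move=> j; rewrite /left_arc_end /u; case: (odd j).
have x2N : x2_first A f 0 North = true.
  rewrite x2_first_right //.
    by apply: has_even_arcs_none => -[|k]; rewrite ?vE ?uE; apply: old_neq; case: (odd _).
  exact: (@has_left_arc false m 0).
have x2S : x2_first A f 0 South = false.
  by rewrite x2_first_left //; apply: (@has_right_arc false m 0).
have noEnd i s : s = East \/ s = West -> x2_first A f i s = f i s.
  by case=> ->; rewrite x2_first_none //; apply: has_even_arcs_none => k;
    rewrite ?vE ?uE; apply: old_neq; case: (odd k).
rewrite /end_square -(noEnd m.+1 East (or_introl erefl)).
rewrite -(noEnd (negz m.+1) West (or_intror erefl)) -!attachE.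
have <- : octagon x1 0 ++ attach x2 A f 0 North ++ attach x2 A f 0 South
    = place x1 x2 (at_ 0) (center false).
  by rewrite (octagonE _ x2) !(attachE x1) x2N x2S -!place_cat.
congr matching_poly; rewrite /G_even_pos.
have -> : m.+2%:Z - 1 = m.+1 by lia.
have -> : [seq Defs.arc R (v i.-1) (v i) | i <- iota 1 m.+1]
    ++ [seq Defs.arc R (u i.-1) (u i) | i <- iota 1 m.+1] = A.
  rewrite (arcs_shift v) (arcs_shift u) /A /even_arcs.
  by congr (_ ++ _); apply: eq_map => i; rewrite ?vE ?uE.
rewrite -[RHS]catA -[X in _ = _ ++ X]catA; do 4 congr (_ ++ _).
by apply: eq_big_union => i _; rewrite !addbF.
Qed.

Lemma matching_even_neg_long m f :
  matching_poly (G_even_neg x1 x2 f m.+2) = even_value x1 x2 true m.+1.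
Proof.
rewrite -(matching_even true f m true true).
pose v (j : nat) := old j (if odd j then NR else SR).
pose u (j : nat) := old (negz j) (if odd j then SL else NL).
have vE : right_arc_end true =1 v by move=> j; rewrite /right_arc_end /v; case: (odd j).
have uE : left_arc_end true =1 u by move=> j; rewrite /left_arc_end /u; case: (odd j).
congr matching_poly; rewrite /G_even_neg.
have -> : [seq Defs.arc R (v i.-1) (v i) | i <- iota 1 m.+1]
    ++ [seq Defs.arc R (u i.-1) (u i) | i <- iota 1 m.+1] = even_arcs true m.
  rewrite (arcs_shift v) (arcs_shift u) /even_arcs.
  by congr (_ ++ _); apply: eq_map => i; rewrite ?vE ?uE.
rewrite (octagonE _ x2); congr (_ ++ _); congr (_ ++ _).
by apply: eq_big_union => i _; rewrite !addbT negbK.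
Qed.

End EvenGraphs.

(** * Solution of the recurrence *)

Section Recurrences.
Variables (R : comNzRingType) (x1 x2 : R).

Lemma matching_odd_pos f k : (0 < k)%N ->
  matching_poly (G_odd_pos x1 x2 f k) = odd_pos_value x1 x2 k.
Proof.
by case: k => [|[|k]] // _; [apply: matching_odd_pos_1|apply: matching_odd_pos_long].
Qed.

Lemma matching_odd_neg f k : (0 < k)%N ->
  matching_poly (G_odd_neg x1 x2 f k) = odd_neg_value x1 x2 k.
Proof.
by case: k => [|[|k]] // _; [apply: matching_odd_neg_1|apply: matching_odd_neg_long].
Qed.

Lemma matching_even_pos f k :
  matching_poly (G_even_pos x1 x2 f k.+1) = even_value x1 x2 false k.
Proof.
case: k => [|k]; last exact: matching_even_pos_long.
by rewrite matching_even_pos_1 /even_value /odd_pos_value /=; ring.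
Qed.

Lemma matching_even_neg f k :
  matching_poly (G_even_neg x1 x2 f k.+1) = even_value x1 x2 true k.
Proof.
case: k => [|k]; last exact: matching_even_neg_long.
by rewrite matching_even_neg_1 /even_value /odd_neg_value /=; ring.
Qed.

Lemma odd_pos_valueSS k :
  odd_pos_value x1 x2 k.+2 =
  (x1 ^+ 4 + (1 + x2) ^+ 2) * odd_pos_value x1 x2 k.+1 - x1 ^+ 4 * x2 ^+ 2 * odd_pos_value x1 x2 k.
Proof. by rewrite /odd_pos_value !chebSS; ring. Qed.

Lemma odd_neg_valueSS k :
  odd_neg_value x1 x2 k.+2 =
  (x1 ^+ 4 + (1 + x2) ^+ 2) * odd_neg_value x1 x2 k.+1 - x1 ^+ 4 * x2 ^+ 2 * odd_neg_value x1 x2 k.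
Proof. by rewrite /odd_neg_value !chebSS; ring. Qed.

End Recurrences.

(** * Transport of the closed forms along ring morphisms *)

Section Morphism.
Variables (R S : comNzRingType) (h : {rmorphism R -> S}) (x1 x2 : R).

Lemma cheb_morph k : h (cheb x1 x2 k) = cheb (h x1) (h x2) k.
Proof.
suff [] : h (cheb x1 x2 k) = cheb (h x1) (h x2) k /\
          h (cheb x1 x2 k.+1) = cheb (h x1) (h x2) k.+1 by [].
elim: k => [|k [IH IH1]]; first by rewrite rmorph0 rmorph1.
by split=> //; rewrite !chebSS -IH -IH1 !(rmorphB, rmorphD, rmorphM, rmorphXn, rmorph1).
Qed.

Lemma odd_pos_value_morph k : h (odd_pos_value x1 x2 k) = odd_pos_value (h x1) (h x2) k.
Proof. by rewrite /odd_pos_value -!cheb_morph !(rmorphB, rmorphD, rmorphM, rmorphXn, rmorph1). Qed.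

Lemma odd_neg_value_morph k : h (odd_neg_value x1 x2 k) = odd_neg_value (h x1) (h x2) k.
Proof. by rewrite /odd_neg_value -!cheb_morph !(rmorphB, rmorphD, rmorphM, rmorphXn, rmorph1). Qed.

Lemma even_value_morph ng k :
  h (even_value x1 x2 ng k) = even_value (h x1) (h x2) ng k.
Proof.
rewrite /even_value; case: ng.
  by rewrite -!odd_neg_value_morph !(rmorphB, rmorphM, rmorphXn).
by rewrite -!odd_pos_value_morph !(rmorphB, rmorphM, rmorphXn).
Qed.

End Morphism.

Lemma cheb10 (R : comNzRingType) k : cheb (1 : R) 0 k.+1 = 2 ^+ k.
Proof.
by elim: k => // k IH; rewrite chebSS IH [RHS]exprS; move: (2 ^+ k) => t; ring.
Qed.

Lemma odd_pos_value10 (R : comNzRingType) k : odd_pos_value (1 : R) 0 k = 2 ^+ k.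
Proof. by rewrite /odd_pos_value cheb10; move: (2 ^+ k) => t; ring. Qed.

Lemma odd_neg_value10 (R : comNzRingType) k : odd_neg_value (1 : R) 0 k = 2 ^+ k.
Proof. by rewrite /odd_neg_value cheb10; move: (2 ^+ k) => t; ring. Qed.

(* At [x1 = 1] and [x2 = 0] the recurrence of [cheb] becomes a geometric progression,
   which shows that the values above are nonzero polynomials. *)
Section Nonzero.
Local Notation ev := (meval (fun i : 'I_2 => if i == ord0 then 1 else 0 : rat)).

Lemma evX1 : ev X1 = 1.
Proof. by rewrite /X1 mevalXU. Qed.

Lemma evX2 : ev X2 = 0.
Proof. by rewrite /X2 mevalXU. Qed.

Lemma even_value10_neq0 ng k : even_value (1 : rat) 0 ng k != 0.
Proof.
case: ng.
  by rewrite /even_value !odd_neg_value10 mul0r subr0 mulf_neq0 ?expf_neq0.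
by rewrite /even_value !odd_pos_value10 mulr0 mul0r subr0 mulf_neq0 ?expf_neq0.
Qed.

Lemma odd_pos_value_neq0 k : odd_pos_value X1 X2 k != 0.
Proof.
apply/eqP => /(congr1 ev)/eqP.
by rewrite odd_pos_value_morph /= evX1 evX2 meval0 odd_pos_value10 expf_eq0 andbF.
Qed.

Lemma odd_neg_value_neq0 k : odd_neg_value X1 X2 k != 0.
Proof.
apply/eqP => /(congr1 ev)/eqP.
by rewrite odd_neg_value_morph /= evX1 evX2 meval0 odd_neg_value10 expf_eq0 andbF.
Qed.

Lemma even_value_neq0 ng k : even_value X1 X2 ng k != 0.
Proof.
apply: contraNneq (even_value10_neq0 ng k) => /(congr1 ev).
by rewrite even_value_morph /= evX1 evX2 meval0 => ->.
Qed.

End Nonzero.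

(** The linear recurrence preserves Y_(k+1)^2 + Y_k^2 - K (Y_(k+1) Y_k - 1), which vanishes at k =
    0. Hence Y_k and Y_(k+1) Y_k - 1 solve the nonlinear system, whose solution is determined term
    by term by dividing by nonzero terms. *)
Lemma recurrence_unique (F : fieldType) (y z Y : nat -> F) (K : F) :
    y 0%N = Y 0%N -> y 1%N = Y 1%N -> z 0%N = Y 1%N * Y 0%N - 1 ->
    (forall k, y k.+1 * y k = z k + 1) ->
    (forall k, z k.+1 * z k = y k.+1 ^+ 4 + 1) ->
    (forall k, Y k.+2 = K * Y k.+1 - Y k) ->
    Y 1%N ^+ 2 + Y 0%N ^+ 2 = K * (Y 1%N * Y 0%N - 1) ->
    (forall k, Y k != 0) -> (forall k, Y k.+1 * Y k - 1 != 0) ->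
  forall k, y k = Y k /\ z k = Y k.+1 * Y k - 1.
Proof.
move=> y0 y1 z0 yz zz YSS inv0 Yn0 Zn0.
have inv k : Y k.+1 ^+ 2 + Y k ^+ 2 = K * (Y k.+1 * Y k - 1).
  elim: k => // k IH; rewrite YSS.
  apply/eqP; rewrite -subr_eq0; apply/eqP.
  transitivity (Y k.+1 ^+ 2 + Y k ^+ 2 - K * (Y k.+1 * Y k - 1)); first by ring.
  by rewrite IH subrr.
suff H k : [/\ y k = Y k, y k.+1 = Y k.+1 & z k = Y k.+1 * Y k - 1].
  by move=> k; case: (H k).
elim: k => [|k [yk yk1 zk]]; first by rewrite y0 y1 z0.
have zk1 : z k.+1 = Y k.+2 * Y k.+1 - 1.
  (* After multiplication by z_k, the two sides differ by Y_(k+1)^2 times the conserved quantity,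
     which is zero. *)
  apply: (mulIf (Zn0 k)); rewrite -[in LHS]zk zz yk1 YSS.
  apply/eqP; rewrite -subr_eq0; apply/eqP.
  transitivity (Y k.+1 ^+ 2 * (Y k.+1 ^+ 2 + Y k ^+ 2 - K * (Y k.+1 * Y k - 1))); first by ring.
  by rewrite inv subrr mulr0.
split=> //; apply: (mulIf (Yn0 k.+1)).
by rewrite -[in LHS]yk1 yz zk1 subrK.
Qed.

Lemma odd_pos_value0 (R : comNzRingType) (x1 x2 : R) : odd_pos_value x1 x2 0 = 1 + x2.
Proof. by rewrite /odd_pos_value /=; ring. Qed.

(** * Closed forms of the terms x_n over a field *)

Section Solutions.
Variables (F : fieldType) (a b : F).
Hypotheses (a0 : a != 0) (b0 : b != 0).

(* The terms of index 2k+1 and 3-2k of the sequence. *)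
Definition ypos k := if k is k'.+1 then odd_pos_value a b k' / (a * (a ^+ 2 * b) ^+ k') else a.
Definition yneg k := if k is k'.+1 then a * odd_neg_value a b k' / (a ^+ 2 * b) ^+ k'
                     else (1 + b) / a.

Let K := (a ^+ 4 + (1 + b) ^+ 2) / (a ^+ 2 * b).

Lemma yposSS k : ypos k.+2 = K * ypos k.+1 - ypos k.
Proof.
case: k => [|k]; rewrite /ypos /K.
  by rewrite /odd_pos_value /= expr1 expr0; field; rewrite ?oner_neq0 ?a0 ?b0.
rewrite odd_pos_valueSS !exprS.
(* This is the power of a^2 b as left by [exprS]; it becomes an atom so that [field] meets no
   symbolic exponent. *)
have: (a * (a * 1) * b) ^+ k != 0 by rewrite expf_neq0 ?mulf_neq0 ?oner_neq0.
move: (_ ^+ k) => T T0.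
by field; rewrite ?oner_neq0 ?T0 ?a0 ?b0.
Qed.

Lemma ynegSS k : yneg k.+2 = K * yneg k.+1 - yneg k.
Proof.
case: k => [|k]; rewrite /yneg /K.
  by rewrite /odd_neg_value /= expr1 expr0; field; rewrite ?oner_neq0 ?a0 ?b0.
rewrite odd_neg_valueSS !exprS.
have: (a * (a * 1) * b) ^+ k != 0 by rewrite expf_neq0 ?mulf_neq0 ?oner_neq0.
move: (_ ^+ k) => T T0.
by field; rewrite ?oner_neq0 ?T0 ?a0 ?b0.
Qed.

Lemma ypos10 : ypos 1 * ypos 0 - 1 = b.
Proof. by rewrite /ypos /odd_pos_value /= expr0; field; rewrite ?oner_neq0 ?a0 ?b0. Qed.

Lemma yneg10 : yneg 1 * yneg 0 - 1 = b.
Proof. by rewrite /yneg /odd_neg_value /= expr0; field; rewrite ?oner_neq0 ?a0 ?b0. Qed.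

Lemma ypos_invariant : ypos 1 ^+ 2 + ypos 0 ^+ 2 = K * (ypos 1 * ypos 0 - 1).
Proof. by rewrite ypos10 /ypos /K /odd_pos_value /= expr0; field; rewrite ?oner_neq0 ?a0 ?b0. Qed.

Lemma yneg_invariant : yneg 1 ^+ 2 + yneg 0 ^+ 2 = K * (yneg 1 * yneg 0 - 1).
Proof. by rewrite yneg10 /yneg /K /odd_neg_value /= expr0; field; rewrite ?oner_neq0 ?a0 ?b0. Qed.

Lemma ypos_even k :
  ypos k.+2 * ypos k.+1 - 1
  = even_value a b false k / (a ^+ 4 * b * (a ^+ 4 * b ^+ 2) ^+ k).
Proof.
rewrite /even_value /ypos exprS.
have -> : (a ^+ 4 * b ^+ 2) ^+ k = ((a ^+ 2 * b) ^+ k) ^+ 2.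
  by rewrite -exprM mulnC exprM; congr (_ ^+ k); ring.
have: (a ^+ 2 * b) ^+ k != 0 by rewrite expf_neq0 ?mulf_neq0 ?expf_neq0.
by move: (_ ^+ k) => T T0; field; rewrite ?oner_neq0 ?T0 ?a0 ?b0.
Qed.

Lemma yneg_even k :
  yneg k.+2 * yneg k.+1 - 1 = even_value a b true k / (b * (a ^+ 4 * b ^+ 2) ^+ k).
Proof.
rewrite /even_value /yneg exprS.
have -> : (a ^+ 4 * b ^+ 2) ^+ k = ((a ^+ 2 * b) ^+ k) ^+ 2.
  by rewrite -exprM mulnC exprM; congr (_ ^+ k); ring.
have: (a ^+ 2 * b) ^+ k != 0 by rewrite expf_neq0 ?mulf_neq0 ?expf_neq0.
by move: (_ ^+ k) => T T0; field; rewrite ?oner_neq0 ?T0 ?a0 ?b0.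
Qed.

Lemma yneg_odd k : yneg k.+2 = odd_neg_value a b k.+1 / (a ^+ (2 * k).+1 * b ^+ k.+1).
Proof.
rewrite /yneg; have -> : (a ^+ 2 * b) ^+ k.+1 = a * (a ^+ (2 * k).+1 * b ^+ k.+1).
  by rewrite exprMn -exprM mulnS mulrA -exprS.
by rewrite invfM mulrACA mulfV // mul1r.
Qed.

Variable x : int -> F.
Hypotheses (x_1 : x 1 = a) (x_2 : x 2 = b).
Hypothesis rec_odd : forall n : int, odd (absz n) -> x n * x (n - 2) = x (n - 1) + 1.
Hypothesis rec_even :
  forall n : int, ~~ odd (absz n) -> x n * x (n - 2) = x (n - 1) ^+ 4 + 1.
Hypothesis pos_neq0 : forall k, odd_pos_value a b k != 0.
Hypothesis neg_neq0 : forall k, odd_neg_value a b k != 0.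
Hypothesis even_neq0 : forall ng k, even_value a b ng k != 0.

Let a2b_neq0 : a ^+ 2 * b != 0.
Proof. by rewrite mulf_neq0 ?expf_neq0. Qed.

Let a4b2_neq0 : a ^+ 4 * b ^+ 2 != 0.
Proof. by rewrite mulf_neq0 ?expf_neq0. Qed.

Let x_3 : x 3 = (1 + b) / a.
Proof.
apply: (mulIf a0); rewrite mulfVK // -x_1.
by have := @rec_odd 3 isT; rewrite -[3 - 2]/1%:Z -[3 - 1]/2%:Z x_2 addrC => ->.
Qed.

Lemma solution_pos k :
  x (k.*2.+1)%:Z = ypos k /\ x (k.*2.+2)%:Z = ypos k.+1 * ypos k - 1.
Proof.
apply: (recurrence_unique (y := fun k => x (k.*2.+1)%:Z) (z := fun k => x (k.*2.+2)%:Z) (Y := ypos)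
   _ _ _ _ _ yposSS ypos_invariant) => //.
- by rewrite x_3 /ypos /odd_pos_value /= expr0 !mulr1 mulr0 subr0.
- by rewrite ypos10.
- move=> {}k; have := @rec_odd (k.+1.*2.+1)%:Z; rewrite doubleS.
  have -> : k.*2.+3%:Z - 2 = k.*2.+1%:Z by lia.
  have -> : k.*2.+3%:Z - 1 = k.*2.+2%:Z by lia.
  by apply; lia.
- move=> {}k; have := @rec_even (k.+1.*2.+2)%:Z; rewrite doubleS.
  have -> : k.*2.+4%:Z - 2 = k.*2.+2%:Z by lia.
  have -> : k.*2.+4%:Z - 1 = k.*2.+3%:Z by lia.
  by apply; lia.
- by case=> [|{}k] //; rewrite /ypos mulf_neq0 ?invr_neq0 ?mulf_neq0 ?expf_neq0.
- case=> [|{}k]; first by rewrite ypos10.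
  by rewrite ypos_even mulf_neq0 ?invr_neq0 ?mulf_neq0 ?expf_neq0.
Qed.

(** The recurrences are symmetric under reversal of the index, so the same uniqueness argument runs
    downwards from x_3, x_2, x_1. *)
Lemma solution_neg k :
  x (3 - (k.*2)%:Z) = yneg k /\ x (2 - (k.*2)%:Z) = yneg k.+1 * yneg k - 1.
Proof.
apply: (recurrence_unique (y := fun k => x (3 - (k.*2)%:Z)) (z := fun k => x (2 - (k.*2)%:Z))
   (Y := yneg) _ _ _ _ _ ynegSS yneg_invariant) => //.
- by rewrite x_1 /yneg /odd_neg_value /= expr0 mulr0 subr0 mulr1 divr1.
- by rewrite yneg10.
- move=> {}k; have := @rec_odd (3 - (k.*2)%:Z); rewrite doubleS.
  have -> : 3 - k.*2%:Z - 2 = 3 - k.*2.+2%:Z by lia.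
  have -> : 3 - k.*2%:Z - 1 = 2 - k.*2%:Z by lia.
  by rewrite mulrC; apply; lia.
- move=> {}k; have := @rec_even (2 - (k.*2)%:Z); rewrite doubleS.
  have -> : 2 - k.*2%:Z - 2 = 2 - k.*2.+2%:Z by lia.
  have -> : 2 - k.*2%:Z - 1 = 3 - k.*2.+2%:Z by lia.
  by rewrite mulrC; apply; lia.
- case=> [|{}k]; last by rewrite /yneg mulf_neq0 ?invr_neq0 ?mulf_neq0 ?expf_neq0.
  by rewrite /yneg -(odd_pos_value0 a b) mulf_neq0 ?invr_neq0.
- case=> [|{}k]; first by rewrite yneg10.
  by rewrite yneg_even mulf_neq0 ?invr_neq0 ?mulf_neq0 ?expf_neq0.
Qed.

End Solutions.

(** * The four ranges of the index, and the conclusion *)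

Lemma tofracX1_neq0 : tofrac X1 != 0.
Proof. by rewrite tofrac_eq0 -msupp_eq0 msuppX. Qed.

Lemma tofracX2_neq0 : tofrac X2 != 0.
Proof. by rewrite tofrac_eq0 -msupp_eq0 msuppX. Qed.

Lemma p_odd_pos f k : p_ f (k.*2.+3)%:Z = odd_pos_value X1 X2 k.
Proof.
rewrite /p_ /G_; have -> : odd `|(k.*2.+3)%:Z|%N by lia.
(* The case k = 0 is the single square. *)
case: k => [|k]; first by rewrite odd_pos_value0; apply: (matching_G_3 X1).
have -> : ((k.+1.*2.+3)%:Z == 3) = false by lia.
have -> : 3 < (k.+1.*2.+3)%:Z by [].
have -> : `|(k.+1.*2.+3)%:Z - 3|./2 = k.+1 by lia.
exact: matching_odd_pos.
Qed.

Lemma p_odd_neg f k : p_ f (- (k.*2.+1)%:Z) = odd_neg_value X1 X2 k.+1.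
Proof.
rewrite /p_ /G_; have -> : odd `|- (k.*2.+1)%:Z|%N by lia.
have -> : (- (k.*2.+1)%:Z == 3) = false by lia.
have -> : (3 < - (k.*2.+1)%:Z) = false by lia.
have -> : `|1 - - (k.*2.+1)%:Z|./2 = k.+1 by lia.
exact: matching_odd_neg.
Qed.

Lemma p_even_pos f k : p_ f (k.*2.+4)%:Z = even_value X1 X2 false k.
Proof.
rewrite /p_ /G_; have -> : odd `|(k.*2.+4)%:Z| = false by lia.
have -> : 2 < (k.*2.+4)%:Z by [].
have -> : `|(k.*2.+4)%:Z - 2|./2 = k.+1 by lia.
exact: matching_even_pos.
Qed.

Lemma p_even_neg f k : p_ f (- (k.*2)%:Z) = even_value X1 X2 true k.
Proof.
rewrite /p_ /G_; have -> : odd `|- (k.*2)%:Z| = false by lia.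
have -> : (2 < - (k.*2)%:Z) = false by lia.
have -> : `|2 - - (k.*2)%:Z|./2 = k.+1 by lia.
exact: matching_even_neg.
Qed.

Lemma m_odd_pos k : m_ (k.*2.+3)%:Z = X1 * (X1 ^+ 2 * X2) ^+ k.
Proof.
rewrite /m_ /sq /oct; have -> : odd `|(k.*2.+3)%:Z|%N by lia.
have -> : (`|(k.*2.+3)%:Z - 1| - 1 = (2 * k).+1)%N by lia.
have -> : ((`|(k.*2.+3)%:Z - 2| - 1)./2 = k)%N by lia.
by rewrite [in RHS]exprMn exprS exprM mulrA.
Qed.

Lemma m_odd_neg k : m_ (- (k.*2.+1)%:Z) = X1 ^+ (2 * k).+1 * X2 ^+ k.+1.
Proof.
rewrite /m_ /sq /oct; have -> : odd `|- (k.*2.+1)%:Z|%N by lia.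
have -> : (`|- (k.*2.+1)%:Z - 1| - 1 = (2 * k).+1)%N by lia.
by have -> : ((`|- (k.*2.+1)%:Z - 2| - 1)./2 = k.+1)%N by lia.
Qed.

Lemma m_even_pos k : m_ (k.*2.+4)%:Z = X1 ^+ 4 * X2 * (X1 ^+ 4 * X2 ^+ 2) ^+ k.
Proof.
rewrite /m_ /sq /oct; have -> : odd `|(k.*2.+4)%:Z| = false by lia.
have -> : (absz (2 * (k.*2.+4)%:Z - 2)%R - 2 = 4 + 4 * k)%N by lia.
have -> : (`|(k.*2.+4)%:Z - 2| - 1 = (2 * k).+1)%N by lia.
by rewrite exprMn -!exprM mulrACA -exprD -exprS.
Qed.

Lemma m_even_neg k : m_ (- (k.*2)%:Z) = X2 * (X1 ^+ 4 * X2 ^+ 2) ^+ k.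
Proof.
rewrite /m_ /sq /oct; have -> : odd `|- (k.*2)%:Z| = false by lia.
have -> : (absz (2 * - (k.*2)%:Z - 2)%R - 2 = 4 * k)%N by lia.
have -> : (`|- (k.*2)%:Z - 2| - 1 = (2 * k).+1)%N by lia.
by rewrite exprMn -!exprM mulrCA -exprS.
Qed.

Variant index_spec : int -> Prop :=
| IndexOddPos k : index_spec (k.*2.+3)%:Z
| IndexOddNeg k : index_spec (- (k.*2.+1)%:Z)
| IndexEvenPos k : index_spec (k.*2.+4)%:Z
| IndexEvenNeg k : index_spec (- (k.*2)%:Z).

Lemma indexP (n : int) : n <> 1 -> n <> 2 -> index_spec n.
Proof.
move=> n1 n2; have [n3|n3] := leP 3 n; case odn: (odd `|n|%N).
- have -> : n = (`|n - 3|./2.*2.+3)%:Z by lia.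
  exact: IndexOddPos.
- have -> : n = (`|n - 4|./2.*2.+4)%:Z by lia.
  exact: IndexEvenPos.
- have -> : n = - (`|n + 1|./2.*2.+1)%:Z by lia.
  exact: IndexOddNeg.
- have -> : n = - (`|n|./2.*2)%:Z by lia.
  exact: IndexEvenNeg.
Qed.

Theorem theorem4 (x : int -> {fraction {mpoly rat[2]}})
    (x_1 : x 1 = tofrac X1) (x_2 : x 2 = tofrac X2)
    (rec_odd : forall n : int, odd (absz n) -> x n * x (n - 2) = x (n - 1) + 1)
    (rec_even : forall n : int, ~~ odd (absz n) ->
       x n * x (n - 2) = x (n - 1) ^+ 4 + 1)
    (f : int -> side -> bool) (n : int) (n_neq1 : n <> 1) (n_neq2 : n <> 2) :
  x n = tofrac (p_ f n) / tofrac (m_ n).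
Proof.
have posE k : odd_pos_value (tofrac X1) (tofrac X2) k = tofrac (odd_pos_value X1 X2 k).
  by rewrite (odd_pos_value_morph (@tofrac _)).
have negE k : odd_neg_value (tofrac X1) (tofrac X2) k = tofrac (odd_neg_value X1 X2 k).
  by rewrite (odd_neg_value_morph (@tofrac _)).
have evenE ng k : even_value (tofrac X1) (tofrac X2) ng k = tofrac (even_value X1 X2 ng k).
  by rewrite (even_value_morph (@tofrac _)).
have posN k : odd_pos_value (tofrac X1) (tofrac X2) k != 0.
  by rewrite posE tofrac_eq0 odd_pos_value_neq0.
have negN k : odd_neg_value (tofrac X1) (tofrac X2) k != 0.
  by rewrite negE tofrac_eq0 odd_neg_value_neq0.
have evenN ng k : even_value (tofrac X1) (tofrac X2) ng k != 0.
  by rewrite evenE tofrac_eq0 even_value_neq0.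
have solP := solution_pos tofracX1_neq0 tofracX2_neq0 x_1 x_2 rec_odd rec_even posN evenN.
have solN := solution_neg tofracX1_neq0 tofracX2_neq0 x_1 x_2 rec_odd rec_even posN negN evenN.
case: (indexP n_neq1 n_neq2) => {n n_neq1 n_neq2} k.
- rewrite p_odd_pos m_odd_pos tofracM tofracXn tofracM tofracXn -posE.
  by have [-> _] := solP k.+1.
- rewrite p_odd_neg m_odd_neg tofracM !tofracXn -negE.
  (* Here 3 - 2(k+2) = -(2k+1); in the last case 2 - 2(k+1) = -2k. *)
  have [+ _] := solN k.+2; rewrite (yneg_odd _ tofracX1_neq0) => <-.
  by congr x; lia.
- rewrite p_even_pos m_even_pos 2!tofracM !tofracXn tofracM !tofracXn -evenE.
  by have [_ ->] := solP k.+1; rewrite (ypos_even tofracX1_neq0 tofracX2_neq0).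
- rewrite p_even_neg m_even_neg tofracM !tofracXn tofracM !tofracXn -evenE.
  have [_] := solN k.+1; rewrite (yneg_even tofracX1_neq0 tofracX2_neq0) => <-.
  by congr x; lia.
Qed.
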